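(* Let $\mu$ be a positive finite Borel measure on $[0,1)$, let $\gamma>0$ and $\delta\in(-\gamma,1-\gamma)$. The following are equivalent: (i) $I_\mu: H^\infty_{v_\gamma}\to H^\infty_{v_{\gamma+\delta}}$ is (well defined and) compact; (ii) $I_\mu: H^\infty_{v_\gamma}\to H^0_{v_{\gamma+\delta}}$ is (well defined and) compact; (iii) $I_\mu: H^0_{v_\gamma}\to H^0_{v_{\gamma+\delta}}$ is (well defined and) compact, and $1/v_\gamma\in L_1([0,1),\mu)$; (iv) $\mu$ is a vanishing $(1-\delta)$-Carleson measure; (v) $\mu_n=o\left(\frac{1}{n^{1-\delta}}\right)$ as $n\to\infty$.
   Context: $\mathbb{D}$ is the open unit disc and $H(\mathbb{D})$ the space of holomorphic functions on $\mathbb{D}$. For a positive finite Borel measure $\mu$ on $[0,1)$, $\mu_n=\int_0^1 t^n\,d\mu(t)$ are its moments, and $I_\mu(f)(z)=\int_0^1\frac{f(t)}{1-tz}\,d\mu(t)$ for $f\in H(\mathbb{D})$ whenever this defines a holomorphic function on $\mathbb{D}$. For $\gamma>0$, $v_\gamma(z)=(1-|z|)^\gamma$; $H^\infty_{v}=\{f\in H(\mathbb{D}):\|f\|_v:=\sup_{z\in\mathbb{D}}v(z)|f(z)|<\infty\}$ and $H^0_v=\{f\in H^\infty_v:\lim_{|z|\to1^-}v(z)|f(z)|=0\}$, Banach spaces with norm $\|\cdot\|_v$. For $s>0$, $\mu$ is a vanishing $s$-Carleson measure if $\mu([t,1))=o((1-t)^s)$ as $t\to1^-$. *)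

(* Defs.v *)
From HB Require Import structures.
From mathcomp Require Import all_boot all_order all_algebra.
From mathcomp Require Import all_classical all_reals all_analysis.
From mathcomp Require Export complex.
Export ComplexField Normc.
Import Order.TTheory GRing.Theory Num.Theory.
Import numFieldNormedType.Exports.

Set Implicit Arguments.
Unset Strict Implicit.
Unset Printing Implicit Defensive.

Local Open Scope classical_set_scope.
Local Open Scope ring_scope.
Local Open Scope complex_scope.

Section Defs.
Variable R : realType.

Definition inD (z : R[i]) : Prop := normc z < 1.

Definition holo (f : R[i] -> R[i]) : Prop :=
  forall z, inD z -> derivable (f : R[i]^o -> R[i]^o) z 1.

Definition vw (gam : R) (z : R[i]) : R := (1 - normc z) `^ gam.

Definition Hinf (v : R[i] -> R) (f : R[i] -> R[i]) : Prop :=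
  holo f /\ exists C : R, forall z, inD z -> v z * normc (f z) <= C.

Definition H0 (v : R[i] -> R) (f : R[i] -> R[i]) : Prop :=
  Hinf v f /\
  forall eps : R, 0 < eps -> exists r : R, r < 1 /\
    forall z, r < normc z -> normc z < 1 -> v z * normc (f z) <= eps.

Variable mu : {measure set R -> \bar R}.

Definition kern (f : R[i] -> R[i]) (z : R[i]) (t : R) : R[i] :=
  f t%:C / (1 - t%:C * z).

Definition Idefined (f : R[i] -> R[i]) : Prop :=
  forall z, inD z ->
    mu.-integrable `[0, 1[%classic (fun t => (complex.Re (kern f z t))%:E) /\
    mu.-integrable `[0, 1[%classic (fun t => (complex.Im (kern f z t))%:E).

Definition Imu (f : R[i] -> R[i]) (z : R[i]) : R[i] :=
  Complex (Rintegral mu `[0, 1[%classic (fun t => complex.Re (kern f z t)))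
          (Rintegral mu `[0, 1[%classic (fun t => complex.Im (kern f z t))).

(* I_mu : X -> Y (with weights vX, vY) is well defined and compact:
   it maps X into Y, and the image of the unit ball of X is relatively
   compact in Y (sequential form: every sequence in the unit ball of X has
   a subsequence whose images converge in the norm of Y to an element of Y) *)
Definition Imu_compact (X : (R[i] -> R[i]) -> Prop) (vX : R[i] -> R)
    (Y : (R[i] -> R[i]) -> Prop) (vY : R[i] -> R) : Prop :=
  (forall f, X f -> Idefined f /\ Y (Imu f)) /\
  forall fs : nat -> R[i] -> R[i],
    (forall n, X (fs n)) ->
    (forall n z, inD z -> vX z * normc (fs n z) <= 1) ->
    exists phi : nat -> nat, (forall k, (phi k < phi k.+1)%N) /\
    exists g, Y g /\
      forall eps : R, 0 < eps -> exists N : nat, forall k, (N <= k)%N ->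
        forall z, inD z -> vY z * normc (Imu (fs (phi k)) z - g z) <= eps.

Definition moment (n : nat) : R := Rintegral mu `[0, 1[%classic (fun t => t ^+ n).

Definition vanishing_carleson (s : R) : Prop :=
  (fun t => fine (mu `[t, 1[%classic) / (1 - t) `^ s) @ at_left 1 --> 0.

End Defs.

(* Main.v *)
(** Put s = 1 - delta, so that gam < s < gam + 1, and write u = 1 - t.

    Everything rests on one estimate: if mu([t,1)) <= eps u^s on [r,1), then
    the integral over [r,1) of u^(-gam) / max(u, x) is at most
    K eps x^(s-gam-1), by summing over the dyadic scales 2^k x, the series
    converging in both directions because gam < s < gam + 1.

    (iv) => (i), (ii), (iii): since |1 - tz| >= max(1-t, 1-|z|), the estimate
    makes I_mu f of size o((1-|z|)^(-(gam+delta))), uniformly over the unit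
    ball of H^infty. Compactness then needs no normal families: the Taylor
    coefficients of I_mu f_n at 0 are the bounded numbers int t^k f_n dmu, a
    diagonal subsequence makes all of them converge, and boundedness of the
    remainders int t^K f_n / (1-tz) dmu makes I_mu f_n uniformly Cauchy on
    every disc |z| <= r < 1; near the unit circle the uniform o(.) takes over.

    (i) or (iii) => (iv): with m an integer larger than gam + 1, the functions
    f_a(z) = (1-a)^(m-gam) / (1-az)^m lie in the unit ball of H^0, and
    |I_mu f_a(a)| (1-a)^(gam+delta) dominates mu([a,1)) / (1-a)^s. A convergent
    subsequence of images shows first that this ratio is bounded; then the
    estimate gives I_mu f_a -> 0 pointwise as a -> 1, so every limit of images
    vanishes and the ratio tends to 0.

    (iv) <=> (v): t^n is bounded by a constant times
    n^(-gam-1) u^(-gam) / max(u, 1/n), while t^n >= 1/2 when n u <= 1/2. *)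

Require Import Defs.
From HB Require Import structures.
From mathcomp Require Import all_boot all_order all_algebra.
From mathcomp Require Import all_classical all_reals all_analysis.
From mathcomp Require Import measurable_realfun ring lra.
Import Order.TTheory GRing.Theory Num.Theory.
Import numFieldNormedType.Exports.

Set Implicit Arguments.
Unset Strict Implicit.

Local Open Scope classical_set_scope.
Local Open Scope ring_scope.
Local Open Scope complex_scope.

(** * Real powers of positive numbers *)

Section PowR.
Variable R : realType.
Implicit Types x y p q : R.

Lemma powR1E q : 1 `^ q = 1 :> R.
Proof. by rewrite powR1. Qed.

Lemma powRD_gt0 x p q : 0 < x -> x `^ (p + q) = x `^ p * x `^ q.
Proof. by move=> x0; rewrite powRD// (gt_eqF x0) implybT. Qed.

Lemma powRB_gt0 x p q : 0 < x -> x `^ (p - q) = x `^ p / x `^ q.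
Proof. by move=> x0; rewrite powRB// (gt_eqF x0) implybT. Qed.

Lemma powRX x p n : 0 <= x -> (x ^+ n) `^ p = (x `^ p) ^+ n.
Proof. by move=> x0; rewrite -powR_mulrn// powRAC powR_mulrn ?powR_ge0. Qed.

Lemma powRV x p : 0 <= x -> (x^-1) `^ p = (x `^ p)^-1.
Proof. by move=> x0; rewrite -powR_inv1// powRAC powR_inv1 ?powR_ge0. Qed.

Lemma ler_powRN x y p : 0 <= p -> 0 < x -> x <= y -> y `^ (- p) <= x `^ (- p).
Proof.
move=> p0 x0 xy; have y0 := lt_le_trans x0 xy.
rewrite !powRN lef_pV2 ?posrE ?powR_gt0//.
by apply: ge0_ler_powR; rewrite ?nnegrE ?(ltW x0) ?(ltW y0).
Qed.

Lemma ler_powR_ge0 x y p : 0 <= p -> 0 <= x -> x <= y -> x `^ p <= y `^ p.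
Proof.
by move=> p0 x0 xy; apply: ge0_ler_powR; rewrite ?nnegrE// (le_trans x0).
Qed.

End PowR.

(** * Integrals against Carleson measures *)

Section DyadicIntegral.
Variables (d : measure_display) (T : measurableType d) (R : realType).
Variable mu : {measure set T -> \bar R}.

(** On [D] the function is dominated by the series of [c n] times the indicator of [A n], which
    integrates term by term into a geometric series. The sets [A n] may overlap, so whole tails can
    stand in for dyadic shells. *)
Lemma integral_le_geometric (D : set T) (f : T -> R) (A : nat -> set T)
    (c : nat -> R) (K q : R) :
  measurable D -> measurable_fun D f -> (forall x, D x -> 0 <= f x) ->
  (forall n, measurable (A n)) -> (forall n, 0 <= c n) ->
  (forall x, D x -> exists n, A n x /\ f x <= c n) ->
  0 < q -> q < 1 ->
  (forall n, ((c n)%:E * mu (D `&` A n) <= (K * q ^+ n)%:E)%E) ->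
  (\int[mu]_(x in D) (f x)%:E <= (K / (1 - q))%:E)%E.
Proof.
move=> mD mf f0 mA c0 fA q0 q1 cK.
pose g (n : nat) (x : T) : \bar R := ((c n)%:E * (\1_(A n) x)%:E)%E.
have g0 n x : (0 <= g n x)%E by rewrite mule_ge0// lee_fin.
have mg n : measurable_fun D (g n).
  apply: measurable_funeM; apply/measurable_EFinP.
  exact: measurable_indic.
have K0 : 0 <= K.
  have := cK 0%N; rewrite expr0 mulr1 => h; rewrite -lee_fin.
  by apply: le_trans h; rewrite mule_ge0// lee_fin.
apply: (@le_trans _ _ (\int[mu]_(x in D) (\sum_(n <oo) g n x))%E).
  apply: ge0_le_integral => //.
  - exact/measurable_EFinP.
  - by apply: ge0_emeasurable_sum => // n x _ _; exact: g0.
  move=> x Dx; have [n [Anx fc]] := fA x Dx.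
  apply: (@le_trans _ _ (g n x)).
    by rewrite /g indicE mem_set// mule1 lee_fin.
  apply: le_trans (nneseries_lim_ge n.+1 _); last by move=> *; exact: g0.
  by rewrite big_mkord big_ord_recr /= leeDr// sume_ge0.
rewrite integral_nneseries//.
have ig n : (\int[mu]_(x in D) g n x = (c n)%:E * mu (D `&` A n))%E.
  rewrite ge0_integralZl_EFin//; first by rewrite integral_indic// setIC.
  by apply/measurable_EFinP; exact: measurable_indic.
under eq_eseriesr do rewrite ig.
apply: lime_le.
  by apply: is_cvg_nneseries => n _ _; rewrite mule_ge0 ?lee_fin ?c0.
apply: nearW => n.
apply: (@le_trans _ _ (series (geometric K q) n)%:E).
  by rewrite /series /= -sumEFin; apply: lee_sum => i _; exact: cK.
by rewrite lee_fin geometric_le_lim// ger0_norm// ltW.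
Qed.

End DyadicIntegral.

(** * The dyadic estimate for the Carleson kernel *)

Section CarlesonKernel.
Variable R : realType.
Variable mu : {finite_measure set R -> \bar R}.
Variables (s gam : R).
Hypotheses (gam0 : 0 < gam) (gams : gam < s) (sgam : s < gam + 1).

(** The same kernel is used at three scales: [x = 1 - |z|] for the growth of [Imu], [x = 1 - a] for
    the test functions, and [x = 1/n] for the moments. *)
Definition ckern (x t : R) : R := (1 - t) `^ (- gam) / Num.max (1 - t) x.

Lemma ckern_ge0 x t : t < 1 -> 0 <= ckern x t.
Proof.
by move=> t1; rewrite divr_ge0 ?powR_ge0// le_max subr_ge0 ltW.
Qed.

Lemma measurable_powR1B (p : R) (D : set R) : measurable_fun D (fun t : R => (1 - t) `^ p).
Proof.
apply: measurableT_comp (measurable_powR p) _.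
exact: measurable_funB.
Qed.

Lemma measurable_ckern x (D : set R) : measurable D -> 0 < x ->
  measurable_fun D (ckern x).
Proof.
move=> mD x0; apply: measurable_funM; first exact: measurable_powR1B.
have -> : (fun t => (Num.max (1 - t) x)^-1) =
    (fun t => (Num.max (1 - t) x) `^ (- 1)).
  by apply/funext => t; rewrite powR_inv1// le_max (ltW x0) orbT.
apply: measurableT_comp (measurable_powR _) _.
by apply: measurable_maxr => //; exact: measurable_funB.
Qed.

(** The two terms sum the geometric series over the scales below and above [x]; the numerators are
    the loss from comparing neighbouring dyadic scales. *)
Definition ccst : R :=
  2 `^ gam / (1 - 2 `^ (- (s - gam))) + 2 `^ s / (1 - 2 `^ (s - gam - 1)).

Lemma powR2_lt1 (p : R) : p < 0 -> 2 `^ p < 1 :> R.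
Proof.
move=> p0; rewrite -[p]opprK powRN invf_lt1 ?powR_gt0//.
have : 1 `^ (- p) < 2 `^ (- p) :> R.
  by apply: gt0_ltr_powR; rewrite ?oppr_gt0 ?nnegrE ?ltr1n.
by rewrite powR1.
Qed.

Lemma ccst_gt0 : 0 < ccst.
Proof.
rewrite addr_gt0// divr_gt0 ?powR_gt0// subr_gt0 powR2_lt1//.
  by rewrite oppr_lt0 subr_gt0.
by rewrite subr_lt0 ltrBlDl.
Qed.

Lemma dyadic_scale (u x : R) : 0 < u -> 0 < x -> exists n, u * 2 ^+ n > x.
Proof.
move=> u0 x0; exists (Num.bound (x / u)); rewrite mulrC -ltr_pdivrMr//.
apply: lt_trans (archi_boundP _) _; first by rewrite divr_ge0// ltW.
by rewrite -natrX ltr_nat ltn_expl.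
Qed.

Section Fixed.
Variables (r eps x : R).
Hypotheses (r1 : r < 1) (eps0 : 0 <= eps) (x0 : 0 < x).
Hypothesis mu_le : forall t, r <= t -> t < 1 ->
  (mu `[t, 1%R[%classic <= (eps * (1 - t) `^ s)%:E)%E.

Let D : set R := `[r, 1[%classic.

Let measurableD : measurable D.
Proof. exact: measurable_itv. Qed.

(** The hypothesis on [mu] only concerns [[t, 1)] with [t >= r]. If [1 - y < r], the set still lies
    in [[r, 1)], whose mass is at most [eps * (1 - r)^s <= eps * y^s]. *)
Lemma tail_le y (E : set R) : 0 < y -> measurable E -> E `<=` D ->
  (mu (E `&` `[(1 - y)%R, 1%R[) <= (eps * y `^ s)%:E)%E.
Proof.
move=> y0 mE ED; have [ry|ry] := leP r (1 - y).
  apply: (@le_trans _ _ (mu `[(1 - y)%R, 1%R[%classic)).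
    by apply: le_measure; rewrite ?inE//; exact: measurableI.
  apply: le_trans (mu_le ry _) _; first by rewrite gtrBl.
  by rewrite opprB addrC subrK.
apply: (@le_trans _ _ (mu `[r, 1%R[%classic)).
  apply: le_measure; rewrite ?inE//; first exact: measurableI.
  by move=> t [/ED].
apply: le_trans (mu_le (lexx r) r1) _.
rewrite lee_fin ler_wpM2l// ler_powR_ge0 ?(ltW (lt_trans gam0 gams))//.
  by rewrite subr_ge0 ltW.
by rewrite lerBlDr -lerBlDl ltW.
Qed.

(** Here [1 - t <= x], so the maximum equals [x]. From one scale [x / 2^k] to the next, the weight
    grows by [2^gam] while the tail bound shrinks by [2^s]; the series converges because
    [gam < s]. *)
Lemma ckern_near : (\int[mu]_(t in D `&` `[(1 - x)%R, +oo[) (ckern x t)%:E <=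
  (2 `^ gam * eps * x `^ (s - gam - 1) / (1 - 2 `^ (- (s - gam))))%:E)%E.
Proof.
have x1 k : 0 < x / 2 ^+ k by rewrite divr_gt0// exprn_gt0.
apply: (@integral_le_geometric _ _ _ mu _ _ (fun k => `[1 - x / 2 ^+ k, 1[%classic)
   (fun k => (x / 2 ^+ k.+1) `^ (- gam) / x)).
- exact: measurableI.
- by apply: measurable_ckern => //; exact: measurableI.
- by move=> t []; rewrite /D/= in_itv/= => /andP[_ t1] _; exact: ckern_ge0.
- by [].
- by move=> k; rewrite divr_ge0 ?powR_ge0 ?ltW.
- move=> t []; rewrite /D/= !in_itv/= andbT => /andP[_ t1].
  rewrite lerBlDr -lerBlDl => ux; have u0 : 0 < 1 - t by rewrite subr_gt0.
  (* The least such [n] puts [1 - t] between [x / 2^(n+1)] and [x / 2^n]. Minimality gives the upper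
     bound when [n > 0]; for [n = 0] it is the assumption [1 - t <= x]. *)
  have /ex_minnP[n nP nmin] : exists n, x < (1 - t) * 2 ^+ n.+1.
    have [n nP] := dyadic_scale u0 x0; exists n; apply: lt_le_trans nP _.
    by rewrite ler_pM2l// ler_eXn2l ?ltr1n.
  exists n; split.
    rewrite in_itv/= t1 andbT lerBlDr -lerBlDl ler_pdivlMr ?exprn_gt0//.
    case: n nP nmin => [|n] _ nmin; first by rewrite mulr1.
    by rewrite leNgt; apply/negP => /nmin; rewrite ltnn.
  rewrite /ckern (max_idPr ux) ler_pM2r ?invr_gt0//.
  by apply: ler_powRN; rewrite ?(ltW gam0)// ler_pdivrMr ?exprn_gt0// ltW.
- by rewrite powR_gt0.
- by rewrite powR2_lt1// oppr_lt0 subr_gt0.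
move=> n; apply: (@le_trans _ _ (((x / 2 ^+ n.+1) `^ (- gam) / x)%:E *
   (eps * (x / 2 ^+ n) `^ s)%:E)%E).
  rewrite lee_wpmul2l ?lee_fin ?divr_ge0 ?powR_ge0 ?(ltW x0)//.
  by apply: tail_le => //; exact: measurableI.
rewrite -EFinM lee_fin le_eqVlt; apply/orP; left; apply/eqP.
rewrite !powRM ?invr_ge0 ?exprn_ge0 ?(ltW x0)//.
rewrite !powRV ?exprn_ge0// !powRX// opprB (@powRB_gt0 _ _ gam s)//.
rewrite expr_div_n (@powRB_gt0 _ _ (s - gam))// (@powRB_gt0 _ _ s)//.
rewrite powRr1 ?(ltW x0)// !powRN exprVn invrK exprS.
have e1 : 2 `^ gam != 0 :> R by rewrite gt_eqF// powR_gt0.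
have e2 : 2 `^ s != 0 :> R by rewrite gt_eqF// powR_gt0.
have e3 : x `^ gam != 0 :> R by rewrite gt_eqF// powR_gt0.
have e4 : (2 `^ s) ^+ n != 0 :> R by rewrite expf_neq0.
have e5 : x != 0 by rewrite gt_eqF.
by field; rewrite e3 e4 e5.
Qed.

(** Here [1 - t > x], so the integrand is [(1 - t)^(-(gam + 1))]. Doubling the scale multiplies the
    terms by [2^(s - gam - 1)], a ratio below 1 because [s < gam + 1]. *)
Lemma ckern_far : (\int[mu]_(t in D `&` `]-oo, (1 - x)%R[) (ckern x t)%:E <=
  (2 `^ s * eps * x `^ (s - gam - 1) / (1 - 2 `^ (s - gam - 1)))%:E)%E.
Proof.
have x1 k : 0 < x * 2 ^+ k by rewrite mulr_gt0// exprn_gt0.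
apply: (@integral_le_geometric _ _ _ mu _ _ (fun k => `[1 - x * 2 ^+ k.+1, 1[%classic)
   (fun k => (x * 2 ^+ k) `^ (- (gam + 1)))).
- exact: measurableI.
- by apply: measurable_ckern => //; exact: measurableI.
- by move=> t []; rewrite /D/= in_itv/= => /andP[_ t1] _; exact: ckern_ge0.
- by [].
- by move=> k; rewrite powR_ge0.
- move=> t []; rewrite /D/= !in_itv/= => /andP[_ t1].
  rewrite ltrBrDr -ltrBrDl => ux; have u0 : 0 < 1 - t by rewrite subr_gt0.
  have /ex_minnP[n nP nmin] : exists n, 1 - t <= x * 2 ^+ n.+1.
    have [n nP] := dyadic_scale x0 u0; exists n; apply: le_trans (ltW nP) _.
    by rewrite ler_pM2l// ler_eXn2l ?ltr1n.
  exists n; split.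
    by rewrite in_itv/= t1 andbT lerBlDr -lerBlDl.
  rewrite /ckern (max_idPl (ltW ux)) -{2}[1 - t]powRr1 ?(ltW u0)//.
  rewrite -powRB_gt0// -opprD; apply: ler_powRN => //.
    by rewrite addr_ge0// ltW.
  case: n nP nmin => [|n] _ nmin; first by rewrite mulr1 ltW.
  by rewrite leNgt; apply/negP => /ltW/nmin; rewrite ltnn.
- by rewrite powR_gt0.
- by rewrite powR2_lt1// subr_lt0 ltrBlDl.
move=> n; apply: (@le_trans _ _ (((x * 2 ^+ n) `^ (- (gam + 1)))%:E *
   (eps * (x * 2 ^+ n.+1) `^ s)%:E)%E).
  rewrite lee_wpmul2l ?lee_fin ?powR_ge0 ?(ltW x0)//.
  by apply: tail_le => //; exact: measurableI.
rewrite -EFinM lee_fin le_eqVlt; apply/orP; left; apply/eqP.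
rewrite !powRM ?invr_ge0 ?exprn_ge0 ?(ltW x0)//.
rewrite !powRX// !powRN !(@powRD_gt0 _ _ gam) ?ltr0n//.
do 2 rewrite (@powRB_gt0 _ _ (s - gam))// (@powRB_gt0 _ _ s)//.
rewrite !powRr1 ?(ltW x0)// !expr_div_n !exprVn !exprMn exprS.
have e1 : (2 `^ gam) ^+ n != 0 :> R by rewrite expf_neq0// gt_eqF// powR_gt0.
have e3 : x `^ gam != 0 :> R by rewrite gt_eqF// powR_gt0.
have e4 : 2 ^+ n != 0 :> R by rewrite expf_neq0.
have e5 : x != 0 by rewrite gt_eqF.
by field; rewrite e1 e3 e4 e5.
Qed.

Lemma carleson_kernel_integral :
  (\int[mu]_(t in D) (ckern x t)%:E <= (ccst * eps * x `^ (s - gam - 1))%:E)%E.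
Proof.
have DE : D = (D `&` `[1 - x, +oo[) `|` (D `&` `]-oo, 1 - x[).
  by rewrite -setIUr -setCitvl setUC setUCr setIT.
rewrite DE ge0_integral_setU//=; first last.
- apply/disj_setPS => t [[_ +] [_]]; rewrite /= !in_itv/= andbT => a b.
  by move: (le_lt_trans a b); rewrite ltxx.
- by move=> t [[]|[]]; rewrite /D/= in_itv/= => /andP[_ t1] _; rewrite lee_fin ckern_ge0.
- by rewrite -DE; apply/measurable_EFinP; exact: measurable_ckern.
- exact: measurableI.
- exact: measurableI.
apply: le_trans (leeD ckern_near ckern_far) _.
rewrite -EFinD lee_fin /ccst le_eqVlt; apply/orP; left; apply/eqP; ring.
Qed.

End Fixed.
End CarlesonKernel.

(** * Complex-valued functions on the disc *)

Section ComplexFacts.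
Variable R : realType.
Implicit Types (z w h : R[i]) (u : nat -> R[i]).

Lemma normc_normE z : (normc z)%:C = `|z|.
Proof. by []. Qed.

Lemma normc_ge0 z : 0 <= normc z.
Proof. by case: z => a b; exact: sqrtr_ge0. Qed.

Lemma ReB z w : complex.Re (z - w) = complex.Re z - complex.Re w.
Proof. by case: z w => [? ?] [? ?]. Qed.

Lemma ImB z w : complex.Im (z - w) = complex.Im z - complex.Im w.
Proof. by case: z w => [? ?] [? ?]. Qed.

Lemma normc_ge_absRe z : `|complex.Re z| <= normc z.
Proof.
case: z => a b /=; rewrite -sqrtr_sqr ler_wsqrtr// lerDl sqr_ge0 //.
Qed.

Lemma normc_ge_absIm z : `|complex.Im z| <= normc z.
Proof.
case: z => a b /=; rewrite -sqrtr_sqr ler_wsqrtr// lerDr sqr_ge0 //.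
Qed.

Lemma normc_le_absReIm z : normc z <= `|complex.Re z| + `|complex.Im z|.
Proof.
case: z => a b /=; rewrite -[leRHS]ger0_norm ?addr_ge0// -sqrtr_sqr ler_wsqrtr//.
by rewrite sqrrD !real_normK ?num_real// lerD2r lerDl mulrn_wge0 ?mulr_ge0.
Qed.

Lemma normc_real (t : R) : normc t%:C = `|t|.
Proof. by rewrite /= expr0n/= addr0 sqrtr_sqr. Qed.

Lemma normcX z n : normc (z ^+ n) = normc z ^+ n.
Proof.
elim: n => [|n IH]; first by rewrite !expr0 normc1.
by rewrite !exprS normcM IH.
Qed.

Lemma normcB z w : normc (z - w) = normc (w - z).
Proof. by rewrite -normcN opprB. Qed.

Lemma normc_triang y z w : normc (z - w) <= normc (z - y) + normc (y - w).
Proof. by apply: le_trans (le_normcD _ _); rewrite addrA subrK. Qed.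

Lemma le_normcB z w : normc (z - w) <= normc z + normc w.
Proof. by rewrite -[normc w]normcN; exact: le_normcD. Qed.

Lemma lerB_normc z w : normc z - normc w <= normc (z - w).
Proof. by rewrite lerBlDr -{1}[z](subrK w) le_normcD. Qed.

Lemma normc_gt0 z : (0 < normc z) = (z != 0).
Proof.
rewrite lt_neqAle normc_ge0 andbT eq_sym; congr (~~ _).
by apply/eqP/eqP => [/eq0_normc//|->]; exact: normc0.
Qed.

Lemma normc_sum n (F : 'I_n -> R[i]) :
  normc (\sum_(k < n) F k) <= \sum_(k < n) normc (F k).
Proof.
elim: n F => [|n IH] F; first by rewrite !big_ord0 (normc0 R).
by rewrite !big_ord_recr/=; apply: le_trans (le_normcD _ _) _; rewrite lerD2r.
Qed.

Lemma real_cauchy (u : nat -> R) :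
  (forall e, 0 < e -> exists N, forall m n, (N <= m)%N -> (N <= n)%N ->
    `|u m - u n| <= e) ->
  exists L, forall e, 0 < e -> exists N, forall n, (N <= n)%N -> `|u n - L| <= e.
Proof.
move=> uC.
have uc : cvg (u @ \oo).
  apply/cauchy_cvgP; apply: cauchy_exP => e e0.
  have [N NP] := uC (e / 2) (divr_gt0 e0 (ltr0Sn _ 1)).
  exists (u N); exists N => // n /= Nn.
  apply: le_lt_trans (NP N n (leqnn _) Nn) _.
  by rewrite ltr_pdivrMr// ltr_pMr// ltr1n.
exists (lim (u @ \oo)) => e e0.
have /cvgrPdist_le/(_ e e0)[N _ NP] := uc.
by exists N => n Nn; rewrite distrC; exact: NP.
Qed.

Lemma complex_cauchy u :
  (forall e : R, 0 < e -> exists N, forall m n, (N <= m)%N -> (N <= n)%N ->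
    normc (u m - u n) <= e) ->
  exists L, forall e : R, 0 < e -> exists N, forall n, (N <= n)%N ->
    normc (u n - L) <= e.
Proof.
move=> uC.
have [a aP] : exists a, forall e, 0 < e -> exists N, forall n, (N <= n)%N ->
    `|complex.Re (u n) - a| <= e.
  apply: real_cauchy => e /uC[N NP]; exists N => m n Nm Nn.
  by rewrite -ReB; apply: le_trans (normc_ge_absRe _) (NP _ _ Nm Nn).
have [b bP] : exists a, forall e, 0 < e -> exists N, forall n, (N <= n)%N ->
    `|complex.Im (u n) - a| <= e.
  apply: real_cauchy => e /uC[N NP]; exists N => m n Nm Nn.
  by rewrite -ImB; apply: le_trans (normc_ge_absIm _) (NP _ _ Nm Nn).
exists (Complex a b) => e e0; have e20 : 0 < e / 2 by rewrite divr_gt0.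
have [N1 N1P] := aP _ e20; have [N2 N2P] := bP _ e20.
exists (maxn N1 N2) => n; rewrite geq_max => /andP[n1 n2].
apply: le_trans (normc_le_absReIm _) _; rewrite ReB ImB [leRHS]splitr.
by rewrite lerD ?N1P ?N2P.
Qed.

Lemma inD_real (t : R) : 0 <= t -> t < 1 -> inD t%:C.
Proof. by move=> t0 t1; rewrite /inD normc_real ger0_norm. Qed.

(** From [|1 - tz| >= 1 - t|z|], since [t|z|] is at most [t] and at most [|z|]. *)
Lemma denom_ge (t : R) z : 0 <= t -> t < 1 -> inD z ->
  Num.max (1 - t) (1 - normc z) <= normc (1 - t%:C * z).
Proof.
move=> t0 t1 zD; apply: le_trans (lerB_normc _ _).
rewrite normc1 normcM normc_real (ger0_norm t0) ge_max !lerD2l !lerN2.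
by rewrite ler_piMr ?(ltW zD)//= ler_piMl ?normc_ge0 ?(ltW t1).
Qed.

Lemma denom_neq0 (t : R) z : 0 <= t -> t < 1 -> inD z -> 1 - t%:C * z != 0.
Proof.
move=> t0 t1 zD; rewrite -normc_gt0; apply: lt_le_trans (denom_ge t0 t1 zD).
by rewrite lt_max subr_gt0 t1.
Qed.

End ComplexFacts.

(** * Holomorphic functions on the disc *)

Section Holo.
Variable R : realType.
Implicit Types (z w h : R[i]) (f g : R[i] -> R[i]).

Lemma holo_eps f z : holo f -> inD z -> forall e : R, 0 < e ->
  exists d : R, 0 < d /\ forall w, normc (w - z) < d -> normc (f w - f z) < e.
Proof.
move=> hf zD e e0.
have /derivable1_diffP/differentiable_continuous fc := hf z zD.
have e0' : 0 < e%:C :> R[i] by rewrite ltcR.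
have /cvgrPdist_lt/(_ _ e0') := fc.
move=> /nbhs_ballP[d /= d0 dP].
(* Balls in the complex numbers have complex radii; a positive one is real, so its real part serves
   as a real radius. *)
have dE : d = (complex.Re d)%:C.
  by apply/esym/RRe_real; rewrite gtr0_real.
exists (complex.Re d); split; first by rewrite -ltcR -dE.
move=> w wd; have /dP : ball (z : R[i]^o) d w.
  by rewrite -ball_normE /= dE -normc_normE ltcR normcB.
by rewrite /= -normc_normE ltcR normcB.
Qed.

Lemma holo_cst (c : R[i]) : holo (fun=> c).
Proof. by move=> z _; exact: derivable_cst. Qed.

Lemma holo_id : holo (fun z : R[i] => z).
Proof. by move=> z _; exact: derivable_id. Qed.

Lemma holoB f g : holo f -> holo g -> holo (fun z => f z - g z).
Proof. by move=> hf hg z zD; apply: derivableB; [exact: hf|exact: hg]. Qed.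

Lemma holoM f g : holo f -> holo g -> holo (fun z => f z * g z).
Proof. by move=> hf hg z zD; apply: derivableM; [exact: hf|exact: hg]. Qed.

Lemma holoX f n : holo f -> holo (fun z => f z ^+ n).
Proof.
move=> hf; elim: n => [|n IH].
  by under eq_fun do rewrite expr0; exact: holo_cst.
by under eq_fun do rewrite exprS; exact: holoM.
Qed.

Lemma holoV f : (forall z, inD z -> f z != 0) -> holo f ->
  holo (fun z => (f z)^-1).
Proof. by move=> f0 hf z zD; apply: derivableV; [exact: f0|exact: hf]. Qed.

(* The hypothesis says |Q h - Q h'| <= C |h - h'| for the difference quotients Q
   of g at z, denominators cleared: it gives convergence of Q without naming the
   derivative, and it passes to pointwise limits of g. *)
Lemma holo_lip_quotient g :
  (forall z, inD z -> exists C d : R, 0 < d /\ forall h h', normc h < d ->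
    normc h' < d ->
    normc (h' * (g (z + h) - g z) - h * (g (z + h') - g z)) <=
      C * (normc h * normc h' * normc (h - h'))) ->
  holo g.
Proof.
move=> gP z zD; have [C0 [d [d0 {}gP]]] := gP z zD.
pose C := `|C0|; pose Q h := (g (z + h) - g z) / h.
have QP h h' : h != 0 -> h' != 0 -> normc h < d -> normc h' < d ->
    normc (Q h - Q h') <= C * normc (h - h').
  move=> h0 h'0 hd h'd.
  have -> : Q h - Q h' =
      (h' * (g (z + h) - g z) - h * (g (z + h') - g z)) / (h * h').
    by rewrite /Q; field; rewrite h0 h'0.
  rewrite normcM normcV ler_pdivrMr ?normc_gt0 ?mulf_neq0//.
  apply: le_trans (gP _ _ hd h'd) _.
  rewrite normcM -[leRHS]mulrA [normc (h - h') * (_ * _)]mulrC; apply: ler_wpM2r.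
    by rewrite !mulr_ge0 ?normc_ge0.
  exact: ler_norm.
(* The shift [n.+2] keeps even the first point strictly inside radius [d]. *)
pose a n : R[i] := (d / n.+2%:R)%:C.
have an n : normc (a n) = d / n.+2%:R by rewrite normc_real ger0_norm// divr_ge0 ?ltW.
have a0 n : a n != 0 by rewrite -normc_gt0 an divr_gt0.
have ad n : normc (a n) < d by rewrite an ltr_pdivrMr// ltr_pMr// ltr1n.
have asmall (e : R) : 0 < e -> exists N, forall n, (N <= n)%N -> normc (a n) <= e.
  move=> e0; exists (Num.bound (d / e)) => n Nn.
  rewrite an ler_pdivrMr// mulrC -ler_pdivrMr//.
  apply: le_trans (ltW (archi_boundP _)) _; first by rewrite divr_ge0 ?ltW.
  by rewrite ler_nat (leq_trans Nn)// leqW// leqW.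
have [L LP] : exists L, forall e : R, 0 < e -> exists N, forall n, (N <= n)%N ->
    normc (Q (a n) - L) <= e.
  apply: complex_cauchy => e e0.
  have C1 : 0 < (C + 1) * 2 by rewrite mulr_gt0// ltr_wpDl// /C.
  have [N NP] := asmall (e / ((C + 1) * 2)) (divr_gt0 e0 C1).
  exists N => m n Nm Nn; apply: le_trans (QP _ _ (a0 m) (a0 n) (ad m) (ad n)) _.
  have := le_trans (le_normcB (a m) (a n)) (lerD (NP _ Nm) (NP _ Nn)).
  have -> : e / ((C + 1) * 2) + e / ((C + 1) * 2) = e / (C + 1).
    by field; rewrite gt_eqF// ltr_wpDl// /C.
  move=> h.
  apply: (@le_trans _ _ ((C + 1) * (e / (C + 1)))).
    by apply: ler_pM => //; rewrite ?normc_ge0 ?lerDl// /C.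
  by rewrite mulrC divfK// gt_eqF// ltr_wpDl// /C.
(* To pass from the sequence [a] to arbitrary [h], compare with some [a n] of modulus at most [|h|]:
   the quotients differ by at most [2C|h|], and [Q (a n)] is within [|h|] of [L]. *)
have QL h : h != 0 -> normc h < d -> normc (Q h - L) <= (C + C + 1) * normc h.
  move=> h0 hd; have hp : 0 < normc h by rewrite normc_gt0.
  have [N1 N1P] := LP _ hp; have [N2 N2P] := asmall _ hp.
  pose n := maxn N1 N2.
  apply: le_trans (normc_triang (Q (a n)) _ _) _.
  rewrite mulrDl mul1r lerD ?N1P ?leq_maxl//.
  apply: le_trans (QP _ _ h0 (a0 n) hd (ad n)) _.
  rewrite mulrDl -mulrDr ler_wpM2l// /C//.
  by apply: le_trans (le_normcB _ _) _; rewrite lerD2l N2P// leq_maxr.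
apply/cvg_ex; exists L; apply/cvgrPdist_le => e e0.
have eE : e = (complex.Re e)%:C by apply/esym/RRe_real; rewrite gtr0_real.
have re0 : 0 < complex.Re e by rewrite -ltcR -eE.
pose D := C + C + 1; have D0 : 0 < D by rewrite ltr_wpDl// addr_ge0 /C.
have m0 : (0 : R[i]) < (Num.min d (complex.Re e / D))%:C.
  by rewrite ltcR lt_min d0 divr_gt0.
near=> h; rewrite eE -normc_normE lecR normcB.
have hn0 : h != 0 by near: h; exact: nbhs_dnbhs_neq.
have : `|h| < (Num.min d (complex.Re e / D))%:C.
  by near: h; exact: (@dnbhs0_lt _ (R[i]^o)).
rewrite -normc_normE ltcR lt_min => /andP[hd he].
have -> : h^-1 *: (g (h *: (1 : R[i]^o) + z) - g z) = Q h :> R[i].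
  rewrite /Q [z + h]addrC -[h *: _]/(h * 1) mulr1.
  by rewrite -[LHS]/(h^-1 * _) mulrC.
apply: le_trans (QL h hn0 hd) _.
by rewrite mulrC -ler_pdivlMr// ltW.
Unshelve. all: by end_near. Qed.

(** The interval [[0, 1)] is enlarged to the open [(-1, 1)], on which [f] is still continuous
    because the whole real diameter lies in the disc; continuity on an open set gives
    measurability. *)
Lemma holo_measurable_ReIm f : holo f ->
  measurable_fun (`[0, 1[%classic : set R) (fun t : R => complex.Re (f t%:C)) /\
  measurable_fun (`[0, 1[%classic : set R) (fun t : R => complex.Im (f t%:C)).
Proof.
move=> hf.
have cont (p : R[i] -> R) : (forall z w, `|p z - p w| <= normc (z - w)) ->
    measurable_fun (`[0, 1[%classic : set R) (fun t : R => p (f t%:C)).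
  move=> pP; apply: (@measurable_funS _ _ _ _ (`]-1, 1[%classic : set R)) => //.
    by apply: subset_itvr; rewrite bnd_simp ltrN10.
  apply: open_continuous_measurable_fun; first exact: interval_open.
  move=> t; rewrite inE /= in_itv/= => /andP[t1 t2].
  apply/cvgrPdist_lt => e e0.
  have tD : inD t%:C by rewrite /inD normc_real ltr_norml t1.
  have [d [d0 dP]] := holo_eps hf tD e0.
  near=> x; apply: le_lt_trans (pP _ _) _; rewrite normcB; apply: dP.
  rewrite -rmorphB normc_real distrC; near: x.
  exact: (@nbhsx_ballx _ _ t d d0).
split; apply: cont => z w.
  by rewrite -ReB normc_ge_absRe.
by rewrite -ImB normc_ge_absIm.
Unshelve. all: by end_near. Qed.

End Holo.

(** * Extraction of subsequences and limits in weighted spaces *)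

Section Limits.
Variable R : realType.

(* By Tychonoff the sequence n |-> x n has a cluster point in the product of
   countably many copies of [-M, M]; no iterated extraction is needed. *)
Lemma diagonal_extraction (x : nat -> nat -> R) (M : R) :
  (forall n k, `|x n k| <= M) ->
  exists phi : nat -> nat, (forall k, (phi k < phi k.+1)%N) /\
    forall k (e : R), 0 < e -> exists N, forall i j, (N <= i)%N -> (N <= j)%N ->
      `|x (phi i) k - x (phi j) k| <= e.
Proof.
move=> xM.
pose A := [set f : prod_topology (fun _ : nat => R) |
  forall i, (`[- M, M]%classic : set R) (f i)].
have cA : compact A.
  by apply: (@tychonoff nat (fun=> R) (fun=> `[- M, M]%classic)) => _; exact: segment_compact.
have FA : ((x : nat -> prod_topology (fun _ : nat => R)) @ \oo) A.
  by exists 0%N => // n _ k /=; rewrite in_itv/= -ler_norml.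
have [c [_ cc]] := cA _ _ FA.
have near_c j N : exists n, (N <= n)%N /\
    forall k, (k <= j)%N -> `|x n k - c k| < j.+1%:R^-1.
  (* Only the coordinates up to [j] are constrained, so this is a neighbourhood in the product
     topology. *)
  have cN : nbhs c [set f : prod_topology (fun _ : nat => R) |
      forall k : 'I_j.+1, `|f k - c k| < j.+1%:R^-1].
    pose U (k : 'I_j.+1) := [set f : prod_topology (fun _ : nat => R) |
      `|f k - c k| < j.+1%:R^-1].
    suff : \forall f \near nbhs c, forall k, U k f by [].
    apply: filter_forall => k.
    have e0 : 0 < (j.+1%:R^-1 : R) by rewrite invr_gt0 ltr0Sn.
    have pc := @proj_continuous nat (fun=> R) k c _ (nbhsx_ballx (c k : R) _ e0).
    have UE : (fun f : prod_topology (fun _ : nat => R) => f k) @^-1`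
        ball (c k : R) j.+1%:R^-1 `<=` U k.
      by move=> f /= fk; rewrite /U /= distrC; exact: fk.
    exact: (@filterS _ (nbhs c) _ _ _ UE pc).
  have FN : ((x : nat -> prod_topology (fun _ : nat => R)) @ \oo)
      [set x n | n in [set n | (N <= n)%N]].
    by exists N => // n /= Nn; exists n.
  have [_ [[n Nn <-] nP]] := cc _ _ FN cN.
  exists n; split => // k kj; exact: (nP (Ordinal (kj : (k < j.+1)%N))).
have /choice[G GP] : forall p : nat * nat, exists n, (p.2 <= n)%N /\
    forall k, (k <= p.1)%N -> `|x n k - c k| < p.1.+1%:R^-1.
  by move=> [j N]; exact: near_c.
(* The second argument of [G] is a lower bound for the chosen index; taking the previous index plus
   one makes [phi] strictly increasing. *)
pose phi := fix phi j := if j is i.+1 then G (j, (phi i).+1) else G (0, 0)%N.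
exists phi; split; first by move=> k /=; have [] := GP (k.+1, (phi k).+1).
have phiP j k : (k <= j)%N -> `|x (phi j) k - c k| < j.+1%:R^-1.
  move=> kj; case: j kj => [|j] kj /=.
    by have [_] := GP (0, 0)%N; exact.
  by have [_] := GP (j.+1, (phi j).+1); exact.
move=> k e e0; pose N := maxn k (Num.bound (2 / e)).
have small j : (N <= j)%N -> `|x (phi j) k - c k| <= e / 2.
  rewrite geq_max => /andP[kj bj]; apply: le_trans (ltW (phiP _ _ kj)) _.
  rewrite -[e / 2]invrK lef_pV2 ?posrE ?invr_gt0 ?divr_gt0// invf_div.
  apply: le_trans (ltW (archi_boundP _)) _; first by rewrite divr_ge0 ?ltW.
  by rewrite ler_nat ltnW.
exists N => i j Ni Nj; rewrite [leRHS]splitr.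
apply: le_trans (ler_distD (c k) _ _) _.
by rewrite lerD ?small// distrC small.
Qed.

Lemma powR_small (p e : R) : 0 < p -> 0 < e ->
  exists r, r < 1 /\ forall x, r < x -> x < 1 -> (1 - x) `^ p <= e.
Proof.
move=> p0 e0; exists (1 - e `^ p^-1); split; first by rewrite gtrBl powR_gt0.
move=> x rx x1; rewrite ltrBlDr -ltrBlDl in rx.
have -> : e = (e `^ p^-1) `^ p by rewrite -powRrM mulVf ?gt_eqF// powRr1 ?ltW.
by rewrite ler_powR_ge0 ?(ltW p0) ?subr_ge0 ?(ltW x1) ?(ltW rx).
Qed.

Lemma vw_gt0 (p : R) z : inD z -> 0 < vw p z.
Proof. by move=> zD; rewrite powR_gt0// subr_gt0. Qed.

Lemma vw_le1 (p : R) z : 0 <= p -> inD z -> vw p z <= 1.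
Proof.
move=> p0 zD; rewrite -[leRHS](@powRr0 _ (1 - normc z)).
by rewrite ger_powR// subr_gt0 zD/= gerBl normc_ge0.
Qed.

(** Local uniform Cauchyness handles compact parts of the disc and uniform smallness handles the
    boundary, so the sequence is Cauchy in norm. The limit is holomorphic because the bound on
    difference quotients is uniform in [j] and survives pointwise limits. *)
Lemma weighted_limit (p : R) (G : nat -> R[i] -> R[i]) : 0 < p ->
  (forall r e : R, r < 1 -> 0 < e -> exists N, forall i j, (N <= i)%N ->
    (N <= j)%N -> forall z, normc z <= r -> normc (G i z - G j z) <= e) ->
  (forall e : R, 0 < e -> exists r : R, r < 1 /\ forall j z, r < normc z ->
    normc z < 1 -> vw p z * normc (G j z) <= e) ->
  (forall z, inD z -> exists C d : R, 0 < d /\ forall j h h', normc h < d ->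
    normc h' < d ->
    normc (h' * (G j (z + h) - G j z) - h * (G j (z + h') - G j z)) <=
      C * (normc h * normc h' * normc (h - h'))) ->
  (exists C, forall j z, inD z -> vw p z * normc (G j z) <= C) ->
  exists g, H0 (vw p) g /\ forall e : R, 0 < e -> exists N, forall k,
    (N <= k)%N -> forall z, inD z -> vw p z * normc (G k z - g z) <= e.
Proof.
move=> p0 Gloc Gvan Glip [C0 GC].
have p0' := ltW p0.
have Gcau (e : R) : 0 < e -> exists N, forall i j, (N <= i)%N -> (N <= j)%N ->
    forall z, inD z -> vw p z * normc (G i z - G j z) <= e.
  move=> e0; have [r [r1 rP]] := Gvan (e / 2) (divr_gt0 e0 (ltr0Sn _ 1)).
  have [N NP] := Gloc r e r1 e0; exists N => i j Ni Nj z zD.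
  have [zr|zr] := leP (normc z) r.
    apply: (@le_trans _ _ (1 * e)); last by rewrite mul1r.
    by apply: ler_pM; rewrite ?NP ?vw_le1 ?normc_ge0 ?(ltW (vw_gt0 _ _)).
  apply: (@le_trans _ _ (vw p z * (normc (G i z) + normc (G j z)))).
    by rewrite ler_wpM2l ?le_normcB// ltW// vw_gt0.
  by rewrite mulrDr [leRHS]splitr lerD ?rP.
(* Outside the disc [g] takes the default value [0]. *)
have /choice[g gP] : forall z, exists L, inD z -> forall e : R, 0 < e ->
    exists N, forall n, (N <= n)%N -> normc (G n z - L) <= e.
  move=> z; have [zD|zD] := pselect (inD z); last by exists 0.
  have [L LP] : exists L, forall e : R, 0 < e ->
    exists N, forall n, (N <= n)%N -> normc (G n z - L) <= e.
    apply: complex_cauchy => e e0.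
    have [N NP] := Gloc (normc z) e zD e0.
    by exists N => m n Nm Nn; exact: NP.
  by exists L.
have Glim (e : R) : 0 < e -> exists N, forall k, (N <= k)%N -> forall z,
    inD z -> vw p z * normc (G k z - g z) <= e.
  move=> e0; have [N NP] := Gcau e e0; exists N => k Nk z zD.
  apply/ler_addgt0Pr => eta eta0.
  (* An index [m] beyond both [N] and [N'] is inserted: [N] is uniform in [z], while [N'] depends on
     [z] and only costs the arbitrary [eta]. *)
  have [N' N'P] := gP z zD eta eta0.
  have kM := leq_maxl k N'; have N'M := leq_maxr k N'.
  have := N'P _ N'M; have := NP k (maxn k N') Nk (leq_trans Nk kM) z zD.
  move: (maxn k N') => m h1 h2.
  apply: (@le_trans _ _ (vw p z * (normc (G k z - G m z) + normc (G m z - g z)))).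
    by rewrite ler_wpM2l ?normc_triang// ltW// vw_gt0.
  rewrite mulrDr lerD// -[leRHS]mul1r.
  by apply: ler_pM; rewrite ?vw_le1 ?normc_ge0 ?(ltW (vw_gt0 _ _)).
exists g; split=> //; split; last first.
  move=> e e0; have e20 := divr_gt0 e0 (ltr0Sn R 1).
  have [r [r1 rP]] := Gvan _ e20; have [N NP] := Glim _ e20.
  exists r; split => // z rz zD.
  apply: (@le_trans _ _ (vw p z * (normc (G N z) + normc (G N z - g z)))).
    rewrite ler_wpM2l ?(ltW (vw_gt0 _ _))//.
    by rewrite -{1}[g z](subKr (G N z)); exact: le_normcB.
  by rewrite mulrDr [leRHS]splitr lerD ?rP// NP.
split; last first.
  have [N NP] := Glim 1 ltr01; exists (C0 + 1) => z zD.
  apply: (@le_trans _ _ (vw p z * (normc (G N z) + normc (G N z - g z)))).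
    rewrite ler_wpM2l ?(ltW (vw_gt0 _ _))//.
    by rewrite -{1}[g z](subKr (G N z)); exact: le_normcB.
  by rewrite mulrDr lerD ?GC// NP.
apply: holo_lip_quotient => z zD.
have [C [d [d0 GP]]] := Glip z zD.
have zd0 : 0 < Num.min d (1 - normc z) by rewrite lt_min d0 subr_gt0.
exists C, (Num.min d (1 - normc z)); split => // h h'.
rewrite !lt_min => /andP[hd hz] /andP[h'd h'z].
apply/ler_addgt0Pr => e e0.
have zhD w : normc w < 1 - normc z -> inD (z + w).
  by rewrite ltrBrDl; exact: le_lt_trans (le_normcD _ _).
(* The approximation errors enter with total coefficient [2(|h| + |h'|)]; adding 1 keeps [S]
   positive when both increments vanish. *)
pose S := (normc h + normc h') * 2 + 1.
have S0 : 0 < S by rewrite ltr_wpDl// mulr_ge0// addr_ge0 ?normc_ge0.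
have [N0 N0P] := gP z zD _ (divr_gt0 e0 S0).
have [N1 N1P] := gP _ (zhD h hz) _ (divr_gt0 e0 S0).
have [N2 N2P] := gP _ (zhD h' h'z) _ (divr_gt0 e0 S0).
pose m := maxn N0 (maxn N1 N2).
have {N0P} a0 : normc (G m z - g z) <= e / S by rewrite N0P// leq_maxl.
have {N1P} a1 : normc (G m (z + h) - g (z + h)) <= e / S.
  by rewrite N1P// !leq_max leqnn orbT.
have {N2P} a2 : normc (G m (z + h') - g (z + h')) <= e / S.
  by rewrite N2P// !leq_max leqnn !orbT.
have -> : h' * (g (z + h) - g z) - h * (g (z + h') - g z) =
  (h' * (G m (z + h) - G m z) - h * (G m (z + h') - G m z)) -
  (h' * ((G m (z + h) - g (z + h)) - (G m z - g z)) -
   h * ((G m (z + h') - g (z + h')) - (G m z - g z))) by ring.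
apply: le_trans (le_normcB _ _) _; rewrite lerD ?GP//.
apply: le_trans (le_normcB _ _) _; rewrite !normcM.
have b1 := le_trans (le_normcB _ _) (lerD a1 a0).
have b2 := le_trans (le_normcB _ _) (lerD a2 a0).
apply: (@le_trans _ _ (normc h' * (e / S + e / S) + normc h * (e / S + e / S))).
  by rewrite lerD// ler_wpM2l ?normc_ge0.
have -> : normc h' * (e / S + e / S) + normc h * (e / S + e / S) =
    (e / S) * ((normc h + normc h') * 2) by ring.
rewrite -[leRHS](divfK (lt0r_neq0 S0)) ler_wpM2l ?divr_ge0 ?(ltW S0) ?(ltW e0)//.
by rewrite /S lerDl.
Qed.

End Limits.

(** * The operator I_mu *)

Section ComplexIntegral.
Variable R : realType.
Variable mu : {finite_measure set R -> \bar R}.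
Implicit Types (k : R -> R[i]) (b : R -> R).

Local Notation I := (`[0, 1[%classic : set R).

Definition cmeasurable k :=
  measurable_fun I (fun t => complex.Re (k t)) /\
  measurable_fun I (fun t => complex.Im (k t)).

Definition cintegrable k :=
  mu.-integrable I (fun t => (complex.Re (k t))%:E) /\
  mu.-integrable I (fun t => (complex.Im (k t))%:E).

(** Integrating real and imaginary parts separately matches the encoding of [Imu], so that [ImuE]
    holds by computation. *)
Definition cint k : R[i] :=
  Complex (Rintegral mu I (fun t => complex.Re (k t)))
          (Rintegral mu I (fun t => complex.Im (k t))).

Lemma cintegrable_le k b : cmeasurable k ->
  (forall t, I t -> normc (k t) <= b t) ->
  mu.-integrable I (EFin \o b) -> cintegrable k.
Proof.
move=> [mR mI] kb ib.
split; apply: le_integrable ib => //.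
- exact/measurable_EFinP.
- move=> t It; rewrite /= lee_fin; apply: le_trans (normc_ge_absRe _) _.
  exact: le_trans (kb _ It) (ler_norm _).
- exact/measurable_EFinP.
- move=> t It; rewrite /= lee_fin; apply: le_trans (normc_ge_absIm _) _.
  exact: le_trans (kb _ It) (ler_norm _).
Qed.

Lemma Rintegral_norm_le (f b : R -> R) : mu.-integrable I (EFin \o f) ->
  mu.-integrable I (EFin \o b) -> (forall t, I t -> `|f t| <= b t) ->
  `|\int[mu]_(t in I) f t| <= \int[mu]_(t in I) b t.
Proof.
move=> fi bi fb; apply: le_trans (le_normr_Rintegral _ fi) _ => //.
apply: le_Rintegral => //.
by have := integrable_abse fi; apply: eq_integrable.
Qed.

(** The factor 2 comes from bounding the real and imaginary parts separately; it only affects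
    constants. *)
Lemma normc_cint_le k b : cintegrable k ->
  (forall t, I t -> normc (k t) <= b t) ->
  mu.-integrable I (EFin \o b) -> normc (cint k) <= 2 * \int[mu]_(t in I) b t.
Proof.
move=> [kR kI] kb ib; apply: le_trans (normc_le_absReIm _) _ => /=.
rewrite mulr2n mulrDl mul1r lerD//; apply: Rintegral_norm_le => // t It.
  exact: le_trans (normc_ge_absRe _) (kb _ It).
exact: le_trans (normc_ge_absIm _) (kb _ It).
Qed.

Lemma eq_cint k1 k2 : (forall t, I t -> k1 t = k2 t) -> cint k1 = cint k2.
Proof.
move=> k12; congr Complex; apply: eq_Rintegral => t; rewrite inE => It;
  by rewrite k12.
Qed.

Lemma cintB k1 k2 : cintegrable k1 -> cintegrable k2 ->
  cint (fun t => k1 t - k2 t) = cint k1 - cint k2 /\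
  cintegrable (fun t => k1 t - k2 t).
Proof.
move=> [R1 I1] [R2 I2].
have eR : (fun t => complex.Re (k1 t - k2 t)) =
  (fun t => complex.Re (k1 t) - complex.Re (k2 t)) by apply/funext => t; rewrite ReB.
have eI : (fun t => complex.Im (k1 t - k2 t)) =
  (fun t => complex.Im (k1 t) - complex.Im (k2 t)) by apply/funext => t; rewrite ImB.
split; first by rewrite /cint eR eI !RintegralB.
by split; [have := integrableB _ R1 R2|have := integrableB _ I1 I2];
  move=> /(_ (measurable_itv _)); apply: eq_integrable => // t _;
  rewrite ?ReB ?ImB EFinB.
Qed.

Lemma cintZ (c : R[i]) k : cintegrable k ->
  cint (fun t => c * k t) = c * cint k /\ cintegrable (fun t => c * k t).
Proof.
case: c => a b [Rk Ik].
have eR : (fun t => complex.Re (Complex a b * k t)) =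
  (fun t => a * complex.Re (k t) - b * complex.Im (k t)).
  by apply/funext => t; case: (k t).
have eI : (fun t => complex.Im (Complex a b * k t)) =
  (fun t => a * complex.Im (k t) + b * complex.Re (k t)).
  by apply/funext => t; case: (k t).
have iZ (x : R) (f : R -> R) : mu.-integrable I (fun t => (f t)%:E) ->
    mu.-integrable I (EFin \o (fun t => x * f t)).
  by move=> fi; have := integrableZl (measurable_itv _) x fi; apply: eq_integrable.
split.
  rewrite /cint eR eI RintegralB ?RintegralD ?RintegralZl//; try exact: iZ.
split.
  have := integrableB (measurable_itv _) (iZ a _ Rk) (iZ b _ Ik).
  by apply: eq_integrable => // t _; rewrite (congr1 (@^~ t) eR) /= EFinB.
have := integrableD (measurable_itv _) (iZ a _ Ik) (iZ b _ Rk).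
by apply: eq_integrable => // t _; rewrite (congr1 (@^~ t) eI) /= EFinD.
Qed.

End ComplexIntegral.

Section Imu.
Variable R : realType.
Variable mu : {finite_measure set R -> \bar R}.
Variables (gam : R).
Hypothesis gam0 : 0 < gam.

Local Notation I := (`[0, 1[%classic : set R).

Lemma itv01P (t : R) : I t -> 0 <= t /\ t < 1.
Proof. by rewrite /= in_itv/= => /andP. Qed.

Lemma ImuE f z : Imu mu f z = cint mu (kern f z).
Proof. by []. Qed.

Definition wint : R := \int[mu]_(t in I) (1 - t) `^ (- gam).

Hypothesis wi : mu.-integrable I (fun t => ((1 - t) `^ (- gam))%:E).

Lemma wint_ge0 : 0 <= wint.
Proof. by apply: Rintegral_ge0 => t _; exact: powR_ge0. Qed.

Lemma wintZ (c : R) : mu.-integrable I (EFin \o (fun t => c * (1 - t) `^ (- gam))) /\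
  \int[mu]_(t in I) (c * (1 - t) `^ (- gam)) = c * wint.
Proof.
split; last by rewrite RintegralZl.
by have := integrableZl (measurable_itv _) c wi; apply: eq_integrable.
Qed.

Section Fixed.
Variables (f : R[i] -> R[i]) (B : R).
Hypothesis hf : holo f.
Hypothesis fB : forall t : R, I t -> normc (f t%:C) <= B * (1 - t) `^ (- gam).

(** Its integral at [z = 0] is the Taylor coefficient of order [n] of [Imu mu f], and at general [z]
    the factor of [z^n] in the Taylor remainder. *)
Definition powkern n z (t : R) : R[i] := t%:C ^+ n * kern f z t.

(** In the variable [t] the kernel is the restriction to [[0, 1)] of a holomorphic function on the
    disc. *)
Lemma powkern_measurable n z : inD z -> cmeasurable (powkern n z).
Proof.
move=> zD; apply: (@holo_measurable_ReIm _ (fun w => w ^+ n * (f w / (1 - w * z)))).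
apply: holoM; first exact/holoX/holo_id.
apply: (holoM hf); apply: holoV.
  move=> w wD; rewrite -normc_gt0; apply: lt_le_trans (lerB_normc _ _).
  rewrite normc1 normcM subr_gt0 -[ltRHS]mulr1.
  by apply: ltr_pM => //; rewrite ?normc_ge0.
apply: holoB; first exact: holo_cst.
by apply: holoM; [exact: holo_id|exact: holo_cst].
Qed.

Lemma powkern_le n z t : inD z -> I t ->
  normc (powkern n z t) <= B / (1 - normc z) * (1 - t) `^ (- gam).
Proof.
move=> zD It; have [t0 t1] := itv01P It.
rewrite /powkern /kern normcM normcX normcM normcV normc_real (ger0_norm t0).
rewrite -[leRHS]mul1r ler_pM ?exprn_ge0 ?exprn_ile1 ?(ltW t1)//.
  by rewrite mulr_ge0 ?invr_ge0 ?normc_ge0.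
rewrite mulrAC ler_pM ?invr_ge0 ?normc_ge0 ?fB//.
have z0 : 0 < 1 - normc z by rewrite subr_gt0.
have h := denom_ge t0 t1 zD.
rewrite lef_pV2 ?posrE//; last by rewrite normc_gt0 denom_neq0.
by apply: le_trans h; rewrite le_max lexx orbT.
Qed.

Lemma powkern_integrable n z : inD z -> cintegrable mu (powkern n z).
Proof.
move=> zD; apply: cintegrable_le (powkern_measurable n zD) _ _.
  by move=> t It; exact: (powkern_le n zD It).
exact: (wintZ _).1.
Qed.

Lemma normc_powkern_int n z : inD z ->
  normc (cint mu (powkern n z)) <= 2 * (B / (1 - normc z) * wint).
Proof.
move=> zD; rewrite -(wintZ _).2.
apply: normc_cint_le (powkern_integrable n zD) _ (wintZ _).1.
by move=> t It; exact: (powkern_le n zD It).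
Qed.

Lemma kern_powkern z : kern f z = powkern 0 z.
Proof. by apply/funext => t; rewrite /powkern expr0 mul1r. Qed.

Lemma Imu_idefined : Idefined mu f.
Proof. by move=> z zD; rewrite kern_powkern; exact: powkern_integrable. Qed.

Lemma inD0 : inD (0 : R[i]).
Proof. by rewrite /inD (normc0 R) ltr01. Qed.

(** This is [1 / (1 - tz) = 1 + tz / (1 - tz)], multiplied by [t^n f(t)] and integrated. *)
Lemma powkern_rec n z : inD z -> cint mu (powkern n z) =
  cint mu (powkern n 0) + z * cint mu (powkern n.+1 z).
Proof.
move=> zD; have [<- zi] := cintZ z (powkern_integrable n.+1 zD).
apply/eqP; rewrite -subr_eq; apply/eqP.
have [<- _] := cintB (powkern_integrable n zD) zi.
apply: eq_cint => t It; have [t0 t1] := itv01P It.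
rewrite /powkern /kern mulr0 subr0 divr1 exprSr.
by field; exact: denom_neq0.
Qed.

Lemma Imu_taylor K z : inD z -> Imu mu f z =
  \sum_(k < K) z ^+ k * cint mu (powkern k 0) + z ^+ K * cint mu (powkern K z).
Proof.
move=> zD; rewrite ImuE kern_powkern; elim: K => [|K IH].
  by rewrite big_ord0 add0r expr0 mul1r.
by rewrite IH big_ord_recr/= (powkern_rec K zD) exprSr; ring.
Qed.

(** For [1 / (1 - tz)] the left side is exactly [t^2 h h' (h - h')] over the product of the
    denominators at [z], [z + h] and [z + h'], each of modulus at least [(1 - |z|) / 2]. The
    constant depends on [f] only through [B], hence is uniform over a ball. *)
Lemma Imu_lip z h h' : inD z -> normc h < (1 - normc z) / 2 ->
  normc h' < (1 - normc z) / 2 ->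
  normc (h' * (Imu mu f (z + h) - Imu mu f z) - h * (Imu mu f (z + h') - Imu mu f z)) <=
  2 * (B / ((1 - normc z) / 2) ^+ 3 * wint) * (normc h * normc h' * normc (h - h')).
Proof.
set d := (1 - normc z) / 2 => zD hd h'd.
have z0 : 0 < 1 - normc z by rewrite subr_gt0.
have d0 : 0 < d by rewrite divr_gt0.
have zd : 1 - normc z = d + d by rewrite /d -splitr.
have near w : normc w < d -> normc (z + w) <= 1 - d.
  move=> wd; apply: le_trans (le_normcD _ _) _.
  by rewrite -[normc z](subKr 1) zd; move: wd; lra.
have nearD w : normc w < d -> inD (z + w).
  by move=> /near; rewrite /inD => /le_lt_trans; apply; rewrite gtrBl.
have [hD h'D] := (nearD _ hd, nearD _ h'd).
have i0 := powkern_integrable 0 zD.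
have i1 := powkern_integrable 0 hD.
have i2 := powkern_integrable 0 h'D.
rewrite !ImuE !kern_powkern.
have [e1 j1] := cintB i1 i0; have [e2 j2] := cintB i2 i0.
have [e3 j3] := cintZ h' j1; have [e4 j4] := cintZ h j2.
have [e5 j5] := cintB j3 j4.
rewrite -e1 -e2 -e3 -e4 -e5.
pose S := normc h * normc h' * normc (h - h').
have S0 : 0 <= S by rewrite !mulr_ge0 ?normc_ge0.
have -> : 2 * (B / d ^+ 3 * wint) * (normc h * normc h' * normc (h - h')) =
  2 * (B / d ^+ 3 * S * wint) by rewrite /S; ring.
rewrite -(wintZ _).2.
apply: normc_cint_le j5 _ (wintZ _).1 => t It; have [t0 t1] := itv01P It.
have dn w : inD w -> d <= 1 - normc w -> d <= normc (1 - t%:C * w).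
  move=> wD dw; apply: le_trans (denom_ge t0 t1 wD).
  by rewrite le_max dw orbT.
have n0 := denom_neq0 t0 t1 zD.
have n1 := denom_neq0 t0 t1 hD.
have n2 := denom_neq0 t0 t1 h'D.
have -> : h' * (powkern 0 (z + h) t - powkern 0 z t) -
    h * (powkern 0 (z + h') t - powkern 0 z t) =
    f t%:C * (t%:C ^+ 2 * (h * h' * (h - h'))) /
    ((1 - t%:C * z) * (1 - t%:C * (z + h)) * (1 - t%:C * (z + h'))).
  by rewrite /powkern /kern; field; rewrite n0 n1 n2.
have SE : normc (h * h' * (h - h')) = S by rewrite !normcM.
rewrite normcM normcV (normcM (f _)) (normcM (_ ^+ 2)) normcX normc_real (ger0_norm t0) SE.
rewrite (normcM (_ * _)) (normcM (1 - _)).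
have -> : B / d ^+ 3 * S * (1 - t) `^ (- gam) =
  B * (1 - t) `^ (- gam) * S / d ^+ 3 by ring.
apply: ler_pM.
- by rewrite !mulr_ge0 ?normc_ge0 ?exprn_ge0.
- by rewrite invr_ge0 !mulr_ge0 ?normc_ge0.
- have t2 : t ^+ 2 * S <= S by rewrite ler_piMl// exprn_ile1// ltW.
  apply: ler_pM (fB It) t2; first exact: normc_ge0.
  by rewrite mulr_ge0 ?exprn_ge0.
rewrite lef_pV2 ?posrE ?exprn_gt0 ?mulr_gt0 ?normc_gt0//.
rewrite -[_ ^+ 3]/(d * (d * d)) mulrA.
have gz w : normc w < d -> d <= 1 - normc (z + w).
  by move=> /near; rewrite lerBrDl -lerBrDr.
have b0 : d <= normc (1 - t%:C * z) by rewrite dn// zd lerDl ltW.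
have b1 := dn _ hD (gz _ hd); have b2 := dn _ h'D (gz _ h'd).
have d0' := ltW d0.
by apply: ler_pM b2; [exact: (mulr_ge0 d0' d0')|exact: d0'|exact: ler_pM b0 b1].
Qed.

End Fixed.
End Imu.

(** * Growth and compactness from small tails *)

Section Sufficiency.
Variable R : realType.
Variable mu : {finite_measure set R -> \bar R}.
Variables (s gam p : R).
Hypotheses (gam0 : 0 < gam) (gams : gam < s) (sgam : s < gam + 1).
Hypothesis pE : p = gam + 1 - s.

Local Notation I := (`[0, 1[%classic : set R).

Definition tail_le_from (r eps : R) := forall t : R, r <= t -> t < 1 ->
  (mu `[t, 1%R[%classic <= (eps * (1 - t) `^ s)%:E)%E.

Section Split.
Variables (r eps : R).
Hypotheses (r0 : 0 <= r) (r1 : r < 1) (eps0 : 0 <= eps).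
Hypothesis tails : tail_le_from r eps.

Let K x : R := (1 - r) `^ (- (gam + 1)) * fine (mu I) +
  ccst s gam * eps * x `^ (s - gam - 1).

(** Split at [r]: on [[0, r)] the kernel is at most [(1 - r)^(-(gam + 1))] whatever [x] is, and on
    [[r, 1)] the dyadic estimate applies. *)
Lemma integral_ckern_le x : 0 < x ->
  (\int[mu]_(t in I) (ckern gam x t)%:E <= (K x)%:E)%E.
Proof.
move=> x0.
have IE : I = `[0, r[%classic `|` `[r, 1[%classic.
  by rewrite -itv_bndbnd_setU// bnd_simp ltW.
have mck (D : set R) : measurable D ->
    measurable_fun D (fun t => (ckern gam x t)%:E).
  by move=> mD; apply/measurable_EFinP; exact: measurable_ckern.
rewrite {1}IE ge0_integral_setU//; first last.
- apply/disj_setPS => t []; rewrite /= !in_itv/= => /andP[_ a] /andP[b _].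
  by move: (le_lt_trans b a); rewrite ltxx.
- by move=> t; rewrite -IE => /itv01P[_ t1]; rewrite lee_fin ckern_ge0.
- by rewrite -IE; apply: mck; exact: measurable_itv.
rewrite /K EFinD; apply: leeD; last first.
  exact: carleson_kernel_integral.
apply: (@le_trans _ _ (\int[mu]_(t in `[0%R, r[)
    (cst ((1 - r) `^ (- (gam + 1)))%:E t)))%E.
  apply: ge0_le_integral => //.
  - by move=> t; rewrite /= in_itv/= => /andP[_ tr];
      rewrite lee_fin ckern_ge0// (lt_trans tr).
  - exact: mck.
  move=> t; rewrite /= in_itv/= => /andP[_ tr].
  have u0 : 0 < 1 - r by rewrite subr_gt0.
  have ru : 1 - r <= 1 - t by rewrite lerD2l lerN2 ltW.
  rewrite lee_fin opprD (@powRD_gt0 _ _ (- gam))// powR_inv1 ?(ltW u0)//.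
  apply: ler_pM; rewrite ?powR_ge0//.
  - by rewrite invr_ge0 le_max (le_trans (ltW u0) ru).
  - by rewrite ler_powRN ?(ltW gam0).
  rewrite lef_pV2 ?posrE//; first by rewrite le_max ru.
  by rewrite lt_max (lt_le_trans u0 ru).
rewrite integral_cst// EFinM lee_wpmul2l ?lee_fin ?powR_ge0//.
rewrite fineK ?fin_num_measure//; apply: le_measure; rewrite ?inE//.
by apply: subset_itvl; rewrite bnd_simp ltW.
Qed.

Lemma ckern_integrable x : 0 < x -> mu.-integrable I (EFin \o ckern gam x).
Proof.
move=> x0; apply/integrableP; split.
  by apply/measurable_EFinP; exact: measurable_ckern.
apply: le_lt_trans (ltry (K x)); apply: le_trans (integral_ckern_le x0).
rewrite le_eqVlt; apply/orP; left; apply/eqP; apply: eq_integral => t.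
by rewrite inE => /itv01P[_ t1]; rewrite /= ger0_norm// ckern_ge0.
Qed.

Lemma Rintegral_ckern_le x : 0 < x -> \int[mu]_(t in I) ckern gam x t <= K x.
Proof.
move=> x0; rewrite -lee_fin; apply: le_trans (integral_ckern_le x0).
by rewrite fineK//; apply: integrable_fin_num => //; exact: ckern_integrable.
Qed.

(** At [x = 1] the maximum in [ckern] is 1 on [[0, 1)], so the kernel reduces to the weight. *)
Lemma weight_integrable : mu.-integrable I (fun t => ((1 - t) `^ (- gam))%:E).
Proof.
have := ckern_integrable ltr01; apply: eq_integrable => // t.
rewrite inE => /itv01P[t0 _].
by rewrite /= /ckern (max_idPr _) ?divr1// gerBl.
Qed.

(** Since [p = gam + 1 - s], the weight cancels [(1 - |z|)^(s - gam - 1)] exactly. Of the two terms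
    left, one vanishes at the unit circle and the other is proportional to [eps]. *)
Lemma Imu_growth (f : R[i] -> R[i]) (B : R) z : holo f -> 0 <= B ->
  (forall t : R, I t -> normc (f t%:C) <= B * (1 - t) `^ (- gam)) -> inD z ->
  vw p z * normc (Imu mu f z) <=
  2 * B * ((1 - r) `^ (- (gam + 1)) * fine (mu I) * vw p z + ccst s gam * eps).
Proof.
move=> hf B0 fB zD; have z0 : 0 < 1 - normc z by rewrite subr_gt0.
have ib : mu.-integrable I (EFin \o (fun t => B * ckern gam (1 - normc z) t)).
  by have := integrableZl (measurable_itv _) B (ckern_integrable z0);
    apply: eq_integrable.
have ci : cintegrable mu (kern f z).
  by rewrite kern_powkern; exact: (powkern_integrable weight_integrable hf fB 0 zD).
have h : normc (Imu mu f z) <= 2 * \int[mu]_(t in I) (B * ckern gam (1 - normc z) t).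
  rewrite ImuE; apply: normc_cint_le ci _ ib => t It.
  have [t0 t1] := itv01P It.
  rewrite /kern normcM normcV /ckern mulrA ler_pM ?invr_ge0 ?normc_ge0 ?fB//.
  rewrite lef_pV2 ?posrE ?denom_ge//; first by rewrite normc_gt0 denom_neq0.
  by rewrite lt_max z0 orbT.
rewrite RintegralZl// in h; last exact: ckern_integrable.
have h2 : normc (Imu mu f z) <= 2 * B * K (1 - normc z).
  apply: le_trans h _; rewrite mulrA ler_wpM2l ?mulr_ge0//.
  exact: Rintegral_ckern_le.
apply: (@le_trans _ _ (vw p z * (2 * B * K (1 - normc z)))).
  by rewrite ler_wpM2l// powR_ge0.
have e1 : vw p z * (1 - normc z) `^ (s - gam - 1) = 1.
  rewrite /vw pE -powRD_gt0//.
  by rewrite (_ : gam + 1 - s + (s - gam - 1) = 0) ?powRr0//; ring.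
rewrite le_eqVlt; apply/orP; left; apply/eqP; rewrite /K.
rewrite (_ : _ * _ = 2 * B * ((1 - r) `^ (- (gam + 1)) * fine (mu I) * vw p z +
  ccst s gam * eps * (vw p z * (1 - normc z) `^ (s - gam - 1)))); last by ring.
by rewrite e1 mulr1.
Qed.

End Split.

(** Epsilon form of the vanishing Carleson condition, by [vanishing_carlesonP]; with [0 <= r] the
    interval [[0, 1)] can be split at [r]. *)
Definition small_tails := forall eps : R, 0 < eps ->
  exists r, [/\ 0 <= r, r < 1 & tail_le_from r eps].

Hypothesis small : small_tails.

Let p0 : 0 < p.
Proof. by rewrite pE subr_gt0. Qed.

Let wi : mu.-integrable I (fun t => ((1 - t) `^ (- gam))%:E).
Proof.
by have [r [r0 r1 rP]] := small ltr01; exact: (weight_integrable r0 r1 ler01 rP).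
Qed.

Section Uniform.
Variable B : R.
Hypothesis B0 : 0 <= B.

Lemma Imu_uniform_vanishing (e : R) : 0 < e -> exists r : R, r < 1 /\
  forall f : R[i] -> R[i], holo f ->
  (forall t : R, I t -> normc (f t%:C) <= B * (1 - t) `^ (- gam)) ->
  forall z, r < normc z -> normc z < 1 -> vw p z * normc (Imu mu f z) <= e.
Proof.
move=> e0; have c0 := ccst_gt0 gams sgam.
have B1 : 0 < B + 1 by rewrite ltr_wpDl.
(* This choice and that of [r'] below make each of the two terms of [Imu_growth] at most [e / 2];
   [B + 1] and [A + 1] avoid division by zero. *)
pose eps := e / (4 * (B + 1) * ccst s gam).
have eps0 : 0 < eps by rewrite divr_gt0 ?mulr_gt0.
have [r [r0 r1 rP]] := small eps0.
pose A := (1 - r) `^ (- (gam + 1)) * fine (mu I).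
have A0 : 0 <= A by rewrite mulr_ge0 ?powR_ge0// fine_ge0.
have A1 : 0 < A + 1 by rewrite ltr_wpDl.
have d0 : 0 < e / (4 * (B + 1) * (A + 1)) by rewrite divr_gt0 ?mulr_gt0.
have [r' [r'1 r'P]] := powR_small p0 d0.
exists r'; split => // f hf fB z rz zD.
apply: le_trans (Imu_growth r0 r1 (ltW eps0) rP hf B0 fB zD) _.
have vz := r'P _ rz zD; rewrite -/(vw p z) -/A in vz *.
apply: (@le_trans _ _ (2 * (B + 1) * ((A + 1) * (e / (4 * (B + 1) * (A + 1))) +
   ccst s gam * eps))).
  have v0 : 0 <= vw p z by rewrite powR_ge0.
  have c0' := ltW c0; have eps0' := ltW eps0.
  apply: ler_pM; first exact: mulr_ge0.
  - by apply: addr_ge0; apply: mulr_ge0.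
  - by rewrite ler_wpM2l// lerDl.
  by rewrite lerD2r; apply: ler_pM => //; rewrite lerDl.
rewrite /eps le_eqVlt; apply/orP; left; apply/eqP.
by field; rewrite !gt_eqF.
Qed.

Lemma Imu_uniform_bound : exists C : R,
  forall f : R[i] -> R[i], holo f ->
  (forall t : R, I t -> normc (f t%:C) <= B * (1 - t) `^ (- gam)) ->
  forall z, inD z -> vw p z * normc (Imu mu f z) <= C.
Proof.
have [r [r0 r1 rP]] := small ltr01.
exists (2 * B * ((1 - r) `^ (- (gam + 1)) * fine (mu I) + ccst s gam)).
move=> f hf fB z zD; apply: le_trans (Imu_growth r0 r1 ler01 rP hf B0 fB zD) _.
rewrite ler_wpM2l ?mulr_ge0// mulr1 lerD2r ler_piMr ?vw_le1 ?(ltW p0)//.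
by rewrite mulr_ge0 ?powR_ge0// fine_ge0.
Qed.

Lemma Imu_H0 f : holo f ->
  (forall t : R, I t -> normc (f t%:C) <= B * (1 - t) `^ (- gam)) ->
  H0 (vw p) (Imu mu f).
Proof.
move=> hf fB; split; last first.
  by move=> e /Imu_uniform_vanishing[r [r1 rP]]; exists r; split => // z; exact: rP.
split; last by have [C CP] := Imu_uniform_bound; exists C => z; exact: CP.
apply: holo_lip_quotient => z zD.
exists (2 * (B / ((1 - normc z) / 2) ^+ 3 * wint mu gam)), ((1 - normc z) / 2).
split; first by rewrite divr_gt0// subr_gt0.
by move=> h h' hd h'd; exact: Imu_lip.
Qed.

End Uniform.

Lemma exprn_small (r e : R) : 0 <= r -> r < 1 -> 0 < e -> exists K, r ^+ K <= e.
Proof.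
move=> r0 r1 e0; have r1' : `|r| < 1 by rewrite ger0_norm.
have /cvgrPdist_le/(_ e e0)[K _ KP] := cvg_geometric 1 r1'.
exists K; have := KP K (leqnn K); rewrite /geometric /= mul1r sub0r normrN.
by rewrite ger0_norm// exprn_ge0.
Qed.

Lemma Imu_subsequence_cauchy (fs : nat -> R[i] -> R[i]) (B : R) : 0 <= B ->
  (forall n, holo (fs n)) ->
  (forall n (t : R), I t -> normc (fs n t%:C) <= B * (1 - t) `^ (- gam)) ->
  exists phi : nat -> nat, (forall k, (phi k < phi k.+1)%N) /\
    forall r e : R, r < 1 -> 0 < e -> exists N, forall i j, (N <= i)%N ->
    (N <= j)%N -> forall z, normc z <= r ->
    normc (Imu mu (fs (phi i)) z - Imu mu (fs (phi j)) z) <= e.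
Proof.
move=> B0 hfs fsB.
have D0 := @inD0 R.
pose c n k := cint mu (powkern (fs n) k 0).
have cB n k : normc (c n k) <= 2 * (B * wint mu gam).
  have := normc_powkern_int wi (hfs n) (fsB n) k D0.
  by rewrite (normc0 R) subr0 divr1.
(* Even entries are real parts and odd entries imaginary parts. *)
pose x n k := if odd k then complex.Im (c n k./2) else complex.Re (c n k./2).
have xB n k : `|x n k| <= 2 * (B * wint mu gam).
  rewrite /x; case: odd; apply: le_trans (cB n k./2).
    exact: normc_ge_absIm.
  exact: normc_ge_absRe.
have [phi [phiS phiP]] := diagonal_extraction xB.
exists phi; split=> // r e r1 e0.
have cphi k (d : R) : 0 < d -> exists N, forall i j, (N <= i)%N -> (N <= j)%N ->
    normc (c (phi i) k - c (phi j) k) <= d.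
  move=> d0; have d20 := divr_gt0 d0 (ltr0Sn R 1).
  have [N1 N1P] := phiP k.*2 _ d20; have [N2 N2P] := phiP k.*2.+1 _ d20.
  exists (maxn N1 N2) => i j; rewrite !geq_max => /andP[i1 i2] /andP[j1 j2].
  apply: le_trans (normc_le_absReIm _) _; rewrite ReB ImB [leRHS]splitr lerD//.
    by have := N1P i j i1 j1; rewrite /x odd_double doubleK.
  by have := N2P i j i2 j2; rewrite /x /= odd_double /= uphalf_double.
(* The given [r] may be negative, whereas powers of the radius must decrease. *)
pose r' := Num.max r 0.
have r'0 : 0 <= r' by rewrite le_max lexx orbT.
have r'1 : r' < 1 by rewrite gt_max r1 ltr01.
pose C := 2 * (B / (1 - r') * wint mu gam).
have w0 := wint_ge0 mu gam.
have C0 : 0 <= C by rewrite !mulr_ge0// invr_ge0 subr_ge0 ltW.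
have C1 : 0 < 4 * (C + 1) by rewrite mulr_gt0// ltr_wpDl.
(* [K] is fixed first, making the difference of remainders at most [e / 2]. The [K] coefficients
   then share the other half, with [K.+1] in the denominator to allow [K = 0]. *)
have [K KP] := exprn_small r'0 r'1 (divr_gt0 e0 C1).
have K0 : 0 < e / (2 * K.+1%:R) by rewrite divr_gt0// mulr_gt0.
have /choice[N NP] := fun k => cphi k _ K0.
exists (\max_(k < K) N k) => i j Ni Nj z zr.
have zr' : normc z <= r' by rewrite le_max zr.
have zD : inD z := le_lt_trans zr' r'1.
rewrite (Imu_taylor wi (hfs _) (fsB _) K zD) (Imu_taylor wi (hfs (phi j)) (fsB _) K zD).
have -> (a b a' b' : R[i]) : a + b - (a' + b') = (a - a') + (b - b') by ring.
rewrite -sumrB -mulrBr [leRHS]splitr.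
apply: le_trans (le_normcD _ _) _; apply: lerD.
  apply: le_trans (normc_sum _) _.
  apply: (@le_trans _ _ (\sum_(k < K) e / (2 * K.+1%:R))).
    apply: ler_sum => k _; rewrite -mulrBr normcM normcX -[leRHS]mul1r.
    apply: ler_pM; rewrite ?exprn_ge0 ?normc_ge0//.
      by rewrite exprn_ile1 ?normc_ge0// ltW.
    by apply: NP; [apply: leq_trans Ni|apply: leq_trans Nj];
      exact: (leq_bigmax (F := fun k : 'I_K => N k)).
  rewrite sumr_const card_ord -[leLHS]mulr_natl.
  rewrite (_ : K%:R * (e / (2 * K.+1%:R)) = e / 2 * (K%:R / K.+1%:R)); last first.
    by rewrite invfM; ring.
  rewrite ler_piMr ?divr_ge0 ?(ltW e0)//.
  by rewrite ler_pdivrMr// mul1r ler_nat.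
rewrite normcM normcX.
have RC n : normc (cint mu (powkern (fs n) K z)) <= C.
  apply: le_trans (normc_powkern_int wi (hfs n) (fsB n) K zD) _.
  rewrite ler_wpM2l// ler_wpM2r// ler_wpM2l// lef_pV2 ?posrE ?subr_gt0//.
  by rewrite lerD2l lerN2.
apply: (@le_trans _ _ (e / (4 * (C + 1)) * (C + C))).
  apply: ler_pM; rewrite ?exprn_ge0 ?normc_ge0//.
    by apply: le_trans KP; rewrite lerXn2r ?nnegrE ?normc_ge0.
  by apply: le_trans (le_normcB _ _) _; rewrite lerD.
apply: (@le_trans _ _ (e / (4 * (C + 1)) * (C + 1 + (C + 1)))).
  by rewrite ler_wpM2l ?divr_ge0 ?(ltW e0) ?(ltW C1)// lerD ?lerDl.
rewrite le_eqVlt; apply/orP; left; apply/eqP.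
by field; rewrite gt_eqF// ltr_wpDl.
Qed.

Lemma Hinf_radial f (C : R) : (forall z, inD z -> vw gam z * normc (f z) <= C) ->
  forall t : R, I t -> normc (f t%:C) <= C * (1 - t) `^ (- gam).
Proof.
move=> fC t /itv01P[t0 t1]; have := fC _ (inD_real t0 t1).
rewrite /vw normc_real (ger0_norm t0) => h.
by rewrite powRN ler_pdivlMr ?powR_gt0 ?subr_gt0// mulrC.
Qed.

(** All images and the limit lie in [H0], so any [X] inside [Hinf] and any [Y] containing [H0] will
    do; this covers the three pairs of spaces at once. *)
Theorem Imu_compact_of_small_tails (X Y : (R[i] -> R[i]) -> Prop) :
  (forall f, X f -> Hinf (vw gam) f) -> (forall f, H0 (vw p) f -> Y f) ->
  Imu_compact mu X (vw gam) Y (vw p).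
Proof.
move=> XH HY; split.
  move=> f /XH[hf [C fC]].
  have fB : forall t : R, I t -> normc (f t%:C) <= `|C| * (1 - t) `^ (- gam).
    by apply: Hinf_radial => z zD; apply: le_trans (fC z zD) (ler_norm _).
  by split; [exact: Imu_idefined fB|apply: HY; exact: Imu_H0 fB].
move=> fs fsX fs1.
have hfs n : holo (fs n) by have [] := XH _ (fsX n).
have fsB n : forall t : R, I t -> normc (fs n t%:C) <= 1 * (1 - t) `^ (- gam).
  by apply: Hinf_radial; exact: fs1.
have [phi [phiS phiP]] := Imu_subsequence_cauchy ler01 hfs fsB.
exists phi; split => //.
have van (e : R) : 0 < e -> exists r : R, r < 1 /\ forall j z, r < normc z ->
    normc z < 1 -> vw p z * normc (Imu mu (fs (phi j)) z) <= e.
  move=> /(Imu_uniform_vanishing ler01)[r [r1 rP]]; exists r; split => // j z.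
  exact: rP (hfs _) (fsB _) z.
have lip z : inD z -> exists C d : R, 0 < d /\ forall j h h', normc h < d ->
    normc h' < d ->
    normc (h' * (Imu mu (fs (phi j)) (z + h) - Imu mu (fs (phi j)) z) -
           h * (Imu mu (fs (phi j)) (z + h') - Imu mu (fs (phi j)) z)) <=
      C * (normc h * normc h' * normc (h - h')).
  move=> zD.
  exists (2 * (1 / ((1 - normc z) / 2) ^+ 3 * wint mu gam)), ((1 - normc z) / 2).
  split; first by rewrite divr_gt0// subr_gt0.
  by move=> j h h' hd h'd; exact: (Imu_lip wi (hfs _) (fsB _) zD hd h'd).
have bound : exists C, forall j z, inD z ->
    vw p z * normc (Imu mu (fs (phi j)) z) <= C.
  have [C CP] := Imu_uniform_bound ler01; exists C => j z.
  exact: CP (hfs _) (fsB _) z.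
have [g [g0 gP]] := weighted_limit p0 phiP van lip bound.
by exists g; split => //; exact: HY.
Qed.

End Sufficiency.

(** * Necessity of the vanishing Carleson condition *)

Section Bump.
Variable R : realType.
Variable gam : R.
Hypothesis gam0 : 0 < gam.

Local Notation I := (`[0, 1[%classic : set R).

(** An integer exponent keeps the denominator of the test function a polynomial; exceeding [gam + 1]
    is what [rbump_le_ckern] needs. *)
Definition bump_order : nat := Num.bound (gam + 1).
Local Notation m := bump_order.

Lemma bump_order_gt : gam + 1 < m%:R.
Proof. by rewrite archi_boundP// addr_ge0// ltW. Qed.

Definition bump (a : R) (z : R[i]) : R[i] :=
  ((1 - a) `^ (m%:R - gam))%:C / (1 - a%:C * z) ^+ m.

Definition rbump (a t : R) : R := (1 - a) `^ (m%:R - gam) / (1 - a * t) ^+ m.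

Lemma bump_real a t : bump a t%:C = (rbump a t)%:C.
Proof. by rewrite /bump /rbump rmorphM fmorphV rmorphXn rmorphB rmorphM rmorph1. Qed.

Section Fixed.
Variable a : R.
Hypotheses (a0 : 0 <= a) (a1 : a < 1).

Let u0 : 0 < 1 - a. Proof. by rewrite subr_gt0. Qed.

Let mgam : 0 < m%:R - gam.
Proof. by rewrite subr_gt0 (lt_trans _ bump_order_gt)// ltrDl. Qed.

Lemma bump_holo : holo (bump a).
Proof.
apply: holoM; first exact: holo_cst.
apply: holoV; first by move=> z zD; rewrite expf_neq0// denom_neq0.
apply: holoX; apply: holoB; first exact: holo_cst.
by apply: holoM; [exact: holo_cst|exact: holo_id].
Qed.

Lemma normc_bump z :
  normc (bump a z) = (1 - a) `^ (m%:R - gam) / normc (1 - a%:C * z) ^+ m.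
Proof. by rewrite normcM normcV normcX normc_real ger0_norm// powR_ge0. Qed.

(** Write [N = |1 - az|] and split [N^m = N^gam * N^(m - gam)]: the first factor dominates
    [(1 - |z|)^gam], the second [(1 - a)^(m - gam)]. *)
Lemma bump_ball z : inD z -> vw gam z * normc (bump a z) <= 1.
Proof.
move=> zD; have z0 : 0 < 1 - normc z by rewrite subr_gt0.
have N0 : 0 < normc (1 - a%:C * z) by rewrite normc_gt0 denom_neq0.
have := denom_ge a0 a1 zD; rewrite ge_max => /andP[Na Nz].
rewrite normc_bump mulrA ler_pdivrMr ?exprn_gt0// mul1r.
have -> : normc (1 - a%:C * z) ^+ m =
    normc (1 - a%:C * z) `^ gam * normc (1 - a%:C * z) `^ (m%:R - gam).
  by rewrite -powRD_gt0// -powR_mulrn ?ltW//; congr (_ `^ _); ring.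
by apply: ler_pM; rewrite ?powR_ge0//;
  [apply: (ler_powR_ge0 (ltW gam0) (ltW z0) Nz)|apply: (ler_powR_ge0 (ltW mgam) (ltW u0) Na)].
Qed.

(** For fixed [a < 1] the denominator stays away from zero, so [bump a] is bounded by [B] and the
    weight alone forces decay at the circle. *)
Lemma bump_H0 : H0 (vw gam) (bump a).
Proof.
pose B := (1 - a) `^ (m%:R - gam) / (1 - a) ^+ m.
have B0 : 0 <= B by rewrite divr_ge0 ?powR_ge0// exprn_ge0// ltW.
have bB z : inD z -> normc (bump a z) <= B.
  move=> zD; rewrite normc_bump ler_wpM2l ?powR_ge0//.
  have := denom_ge a0 a1 zD; rewrite ge_max => /andP[Na _].
  rewrite lef_pV2 ?posrE ?exprn_gt0 ?(lt_le_trans u0 Na)//.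
  by rewrite lerXn2r ?nnegrE ?(ltW u0)// (le_trans (ltW u0)).
split; first by split; [exact: bump_holo|exists 1 => z; exact: bump_ball].
move=> e e0; have B1 : 0 < B + 1 by rewrite ltr_wpDl.
have [r [r1 rP]] := powR_small gam0 (divr_gt0 e0 B1).
exists r; split => // z rz zD.
rewrite -(divfK (lt0r_neq0 B1) e); apply: ler_pM (rP _ rz zD) _.
- exact: powR_ge0.
- exact: normc_ge0.
by apply: le_trans (bB _ zD) _; rewrite lerDl.
Qed.

Lemma rbump_denom t : t < 1 -> a <= t -> 1 - a * t <= 2 * (1 - a).
Proof.
move=> t1 a_t; rewrite -subr_ge0.
have -> : 2 * (1 - a) - (1 - a * t) = (1 - a) - a * (1 - t) by ring.
rewrite subr_ge0; apply: (@le_trans _ _ (1 - t)); last by rewrite lerD2l lerN2.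
by rewrite ler_piMl ?(ltW a1)// subr_ge0 ltW.
Qed.

Lemma rbump_denom_gt0 t : I t -> 0 < 1 - a * t.
Proof.
move=> /itv01P[t0 t1]; rewrite subr_gt0; apply: le_lt_trans t1.
by rewrite ler_piMl ?(ltW a1).
Qed.

Lemma rbump_ge t : t < 1 -> a <= t -> (2 ^+ m)^-1 * (1 - a) `^ (- gam) <= rbump a t.
Proof.
move=> t1 a_t; have d0 : 0 < 1 - a * t.
  by apply: rbump_denom_gt0; rewrite /= in_itv/= (le_trans a0 a_t).
apply: (@le_trans _ _ ((1 - a) `^ (m%:R - gam) / (2 * (1 - a)) ^+ m)).
  rewrite powRB_gt0// powR_mulrn ?(ltW u0)// powRN exprMn.
  rewrite le_eqVlt; apply/orP; left; apply/eqP; field.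
  by rewrite !expf_neq0 ?(gt_eqF u0)// gt_eqF// powR_gt0.
rewrite ler_wpM2l ?powR_ge0// lef_pV2 ?posrE ?exprn_gt0 ?mulr_gt0//.
by rewrite lerXn2r ?nnegrE ?rbump_denom ?(ltW d0)// mulr_ge0// ltW.
Qed.

(** With [N = max(1 - t, 1 - a) <= 1 - at], split [N^m = N^q * N^gam * N], where
    [q = m - gam - 1 >= 0]; then [N^q >= (1 - a)^q] and [N^gam >= (1 - t)^gam]. The factor [1 - a]
    gained is what makes the images tend to zero pointwise. *)
Lemma rbump_le_ckern t : I t -> rbump a t <= (1 - a) * ckern gam (1 - a) t.
Proof.
move=> It; have d0 := rbump_denom_gt0 It; have [t0 t1] := itv01P It.
have v0 : 0 < 1 - t by rewrite subr_gt0.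
pose N := Num.max (1 - t) (1 - a).
have N0 : 0 < N by rewrite lt_max v0.
have Nd : N <= 1 - a * t by rewrite ge_max !lerD2l !lerN2 ler_piMl ?(ltW a1)//= ler_piMr// ltW.
apply: (@le_trans _ _ ((1 - a) `^ (m%:R - gam) / N ^+ m)).
  rewrite ler_wpM2l ?powR_ge0// lef_pV2 ?posrE ?exprn_gt0//.
  by rewrite lerXn2r ?nnegrE ?(ltW N0) ?(ltW d0).
pose q : R := m%:R - gam - 1.
have q0 : 0 <= q by rewrite /q -addrA -opprD subr_ge0 ltW// bump_order_gt.
have NE : N `^ m%:R = N `^ q * (N `^ gam * N).
  rewrite -[X in _ * (_ * X)](powRr1 (ltW N0)) -!powRD_gt0//.
  by congr (_ `^ _); rewrite /q; ring.
have uE : (1 - a) `^ (m%:R - gam) = (1 - a) `^ q * (1 - a).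
  rewrite -[X in _ * X](powRr1 (ltW u0)) -powRD_gt0//.
  by congr (_ `^ _); rewrite /q; ring.
rewrite -powR_mulrn ?(ltW N0)// NE uE /ckern -/N.
rewrite ler_pdivrMr ?mulr_gt0 ?powR_gt0//.
have -> : (1 - a) * ((1 - t) `^ (- gam) / N) * (N `^ q * (N `^ gam * N))
  = N `^ q * (N `^ gam * (1 - t) `^ (- gam)) * (1 - a).
  by field; rewrite gt_eqF.
rewrite ler_pM2r// -[leLHS]mulr1; apply: ler_pM; rewrite ?powR_ge0//.
  by rewrite ler_powR_ge0 ?(ltW u0)// le_max lexx orbT.
rewrite powRN ler_pdivlMr ?powR_gt0// mul1r.
by rewrite ler_powR_ge0 ?(ltW gam0) ?(ltW v0)// le_max lexx.
Qed.

End Fixed.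
End Bump.

(** * From compactness to small tails *)

Section Necessity.
Variable R : realType.
Variable mu : {finite_measure set R -> \bar R}.
Variables (s gam p : R).
Hypotheses (gam0 : 0 < gam) (gams : gam < s) (sgam : s < gam + 1).
Hypothesis pE : p = gam + 1 - s.

Local Notation I := (`[0, 1[%classic : set R).

Definition carleson_ratio (a : R) : R :=
  fine (mu (`[a, 1[%classic : set R)) / (1 - a) `^ s.

(** One factor 2 for each of the [bump_order gam] factors in the denominator of the bump, and one
    for [1 - ta] in the kernel. *)
Let c0 : R := (2 ^+ (bump_order gam).+1)^-1.

Let c0_gt0 : 0 < c0.
Proof. by rewrite invr_gt0 exprn_gt0. Qed.

(** At the real point [z = a] the integrand is real and nonnegative, so the integral may be cut down
    to [[a, 1)], where [1 - at <= 2(1 - a)]. *)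
Lemma Imu_bump_ge a : 0 <= a -> a < 1 -> Idefined mu (bump gam a) ->
  c0 * carleson_ratio a <= vw p a%:C * normc (Imu mu (bump gam a) a%:C).
Proof.
move=> a0 a1 def; have u0 : 0 < 1 - a by rewrite subr_gt0.
have aD : inD a%:C by exact: inD_real.
have [ri _] := def _ aD.
pose g t := rbump gam a t / (1 - t * a).
have gE t : complex.Re (kern (bump gam a) a%:C t) = g t.
  by rewrite /kern bump_real -rmorphM -(rmorph1 (real_complex R)) -rmorphB -fmorphV -rmorphM.
have gi : mu.-integrable I (EFin \o g).
  by apply: eq_integrable ri => // t _; rewrite gE.
pose k : R := c0 * (1 - a) `^ (- (gam + 1)).
have k0 : 0 <= k by rewrite mulr_ge0 ?powR_ge0// ltW.
have g0 t : I t -> 0 <= g t.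
  move=> It; have := rbump_denom_gt0 a1 It => d0.
  by rewrite divr_ge0 1?[t * a]mulrC ?(ltW d0)// divr_ge0 ?powR_ge0 ?exprn_ge0 ?(ltW d0).
have subI : (`[a, 1[%classic : set R) `<=` I.
  by apply: subset_itvr; rewrite bnd_simp.
have kg t : (`[a, 1[%classic : set R) t -> k <= g t.
  move=> at1; have := at1; rewrite /= in_itv/= => /andP[a_t t1].
  have d0 := rbump_denom_gt0 a1 (subI _ at1).
  rewrite /k /c0 exprSr invfM opprD powRD_gt0// powR_inv1 ?(ltW u0)//.
  rewrite mulrACA -invfM; apply: ler_pM.
  - by rewrite mulr_ge0 ?powR_ge0// invr_ge0 exprn_ge0.
  - by rewrite invr_ge0 mulr_ge0// ltW.
  - exact: rbump_ge.
  by rewrite lef_pV2 ?posrE ?mulr_gt0 1?[t * a]mulrC// rbump_denom.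
have kint : k * fine (mu (`[a, 1[%classic : set R)) <= \int[mu]_(t in I) g t.
  rewrite -lee_fin EFinM fineK ?fin_num_measure//.
  rewrite fineK; last by exact: integrable_fin_num gi.
  rewrite -integral_cst//.
  apply: (@le_trans _ _ (\int[mu]_(t in `[a, 1%R[) (g t)%:E)%E).
    apply: ge0_le_integral => //.
    by apply/measurable_EFinP; apply: measurable_funS subI _ => //;
      apply/measurable_EFinP; case/integrableP: gi.
  apply: ge0_subset_integral => //; first by case/integrableP: gi.
apply: (@le_trans _ _ (vw p a%:C * (k * fine (mu (`[a, 1[%classic : set R))))).
  rewrite /vw normc_real (ger0_norm a0) /k /carleson_ratio -powRN.
  have -> : - s = p + (- (gam + 1)) by rewrite pE; ring.
  by rewrite powRD_gt0// le_eqVlt; apply/orP; left; apply/eqP; ring.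
rewrite ler_wpM2l ?powR_ge0//; apply: le_trans kint _.
apply: le_trans (normc_ge_absRe _); apply: le_trans (ler_norm _).
by rewrite /Imu /= le_eqVlt; apply/orP; left; apply/eqP;
  apply: eq_Rintegral => t _; rewrite gE.
Qed.

Lemma leq_increasing (phi : nat -> nat) : (forall k, (phi k < phi k.+1)%N) ->
  forall k, (k <= phi k)%N.
Proof. by move=> h; elim=> // k IH; exact: leq_ltn_trans IH (h k). Qed.

Variables (X Y : (R[i] -> R[i]) -> Prop).
Hypotheses (HX : forall f, H0 (vw gam) f -> X f)
           (YH : forall f, Y f -> Hinf (vw p) f).
Hypothesis cpt : Imu_compact mu X (vw gam) Y (vw p).

Lemma bump_subsequence (a : nat -> R) : (forall n, 0 <= a n /\ a n < 1) ->
  exists phi : nat -> nat, (forall k, (k <= phi k)%N) /\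
  exists g, Hinf (vw p) g /\
  forall e : R, 0 < e -> exists N : nat, forall k, (N <= k)%N -> forall z, inD z ->
    vw p z * normc (Imu mu (bump gam (a (phi k))) z - g z) <= e.
Proof.
move=> aP; have aX n : X (bump gam (a n)).
  by have [? ?] := aP n; apply: HX; exact: bump_H0.
have [phi [phiS [g [Yg gP]]]] := cpt.2 (fun n => bump gam (a n)) aX
  (fun n z zD => bump_ball gam0 (aP n).1 (aP n).2 zD).
exists phi; split; first exact: leq_increasing.
by exists g; split => //; exact: YH.
Qed.

Let bump_def a : 0 <= a -> a < 1 -> Idefined mu (bump gam a).
Proof. by move=> a0 a1; apply: (cpt.1 _ _).1; apply: HX; exact: bump_H0. Qed.

(** Otherwise choose [a n] with ratio above [n]. Images within distance 1 of a limit of norm at most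
    [C] have norm at most [1 + C], which contradicts [Imu_bump_ge] far along the subsequence. *)
Lemma carleson_ratio_bounded :
  exists C, 0 <= C /\ forall a, 0 <= a -> a < 1 -> carleson_ratio a <= C.
Proof.
apply: contrapT => nb.
have /choice[a aP] : forall n : nat, exists a, (0 <= a /\ a < 1) /\
    n%:R < carleson_ratio a.
  move=> n; apply: contrapT => na; apply: nb; exists n%:R; split => // a a0 a1.
  by rewrite leNgt; apply/negP => h; apply: na; exists a.
have [phi [phi_k [g [[_ [C gC]] gP]]]] := bump_subsequence (fun n => (aP n).1).
have [N NP] := gP 1 ltr01.
pose k := maxn N (Num.bound (`|1 + C| / c0)).
have [[a0 a1] aL] := aP (phi k).
have aD := inD_real a0 a1.
have := NP k (leq_maxl _ _) _ aD.
have := Imu_bump_ge a0 a1 (bump_def a0 a1).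
move: (Imu mu _ _) => F h1 h2.
have h3 : vw p (a (phi k))%:C * normc F <= 1 + C.
  apply: le_trans (lerD h2 (gC _ aD)); rewrite -mulrDr.
  by rewrite ler_wpM2l ?powR_ge0// -{1}[F](subrK (g (a (phi k))%:C)) le_normcD.
have kb : `|1 + C| / c0 < (phi k)%:R.
  apply: lt_le_trans (archi_boundP _) _; first by rewrite divr_ge0// ltW.
  by rewrite ler_nat (leq_trans (leq_maxr _ _) (phi_k k)).
rewrite ltr_pdivrMr// in kb.
have : `|1 + C| < 1 + C.
  apply: lt_le_trans kb _; apply: le_trans (le_trans h1 h3).
  by rewrite mulrC ler_pM2l// ltW.
by rewrite ltNge ler_norm.
Qed.

Lemma carleson_ratio_tail a c : a < 1 -> carleson_ratio a <= c ->
  (mu `[a, 1%R[%classic <= (c * (1 - a) `^ s)%:E)%E.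
Proof.
move=> a1; rewrite /carleson_ratio ler_pdivrMr ?powR_gt0 ?subr_gt0// => h.
by rewrite -[leLHS]fineK ?fin_num_measure// lee_fin.
Qed.

(** The estimate with [r = 0] and [x = 1 - a], times the factor [1 - a] of [rbump_le_ckern], leaves
    a multiple of [(1 - a)^(s - gam)], which tends to zero since [gam < s]. *)
Lemma Imu_bump_small C : 0 <= C -> tail_le_from mu s 0 C ->
  forall z, inD z -> forall e : R, 0 < e -> exists r, r < 1 /\
  forall a, 0 <= a -> r < a -> a < 1 -> normc (Imu mu (bump gam a) z) <= e.
Proof.
move=> C0 tails z zD e e0; have z0 : 0 < 1 - normc z by rewrite subr_gt0.
pose A := 2 / (1 - normc z) * (fine (mu I) + ccst s gam * C).
have A0 : 0 <= A.
  rewrite mulr_ge0 ?divr_ge0 ?(ltW z0)// addr_ge0 ?fine_ge0//.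
  by rewrite mulr_ge0// ltW// ccst_gt0.
have A1 : 0 < A + 1 by rewrite ltr_wpDl.
have th0 : 0 < s - gam by rewrite subr_gt0.
have [r [r1 rP]] := powR_small th0 (divr_gt0 e0 A1).
exists r; split=> // a a0 ra a1; have u0 : 0 < 1 - a by rewrite subr_gt0.
have ki := ckern_integrable gam0 gams sgam (lexx 0) ltr01 C0 tails u0.
have ib : mu.-integrable I (EFin \o (fun t => (1 - a) / (1 - normc z) * ckern gam (1 - a) t)).
  by have := integrableZl (measurable_itv _) ((1 - a) / (1 - normc z)) ki;
    apply: eq_integrable.
have h : normc (Imu mu (bump gam a) z) <=
    2 * \int[mu]_(t in I) ((1 - a) / (1 - normc z) * ckern gam (1 - a) t).
  rewrite ImuE; apply: normc_cint_le ib; first exact: bump_def.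
  move=> t It; have [t0 t1] := itv01P It.
  rewrite /kern bump_real normcM normcV normc_real mulrAC.
  apply: ler_pM; rewrite ?normr_ge0 ?invr_ge0 ?normc_ge0//.
    rewrite ger0_norm ?rbump_le_ckern//.
    by rewrite divr_ge0 ?powR_ge0// exprn_ge0// ltW// rbump_denom_gt0.
  rewrite lef_pV2 ?posrE ?normc_gt0 ?denom_neq0//.
  by apply: le_trans (denom_ge t0 t1 zD); rewrite le_max lexx orbT.
apply: le_trans h _; rewrite RintegralZl//.
have k1 := Rintegral_ckern_le gam0 gams sgam (lexx 0) ltr01 C0 tails u0.
rewrite subr0 powR1 mul1r in k1.
apply: (@le_trans _ _ ((A + 1) * (1 - a) `^ (s - gam))); last first.
  by rewrite mulrC -ler_pdivlMr// rP.
apply: (@le_trans _ _ (A * (1 - a) `^ (s - gam))); last first.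
  by rewrite ler_wpM2r ?powR_ge0// lerDl.
have e1 : (1 - a) * (1 - a) `^ (s - gam - 1) = (1 - a) `^ (s - gam).
  by rewrite mulr_powRB1// ltW.
(* The exponent [s - gam] is below 1, so the total mass term is absorbed too. *)
have e2 : 1 - a <= (1 - a) `^ (s - gam).
  by rewrite ger1_powR ?u0 ?gerBl// lerBlDl ltW.
apply: (@le_trans _ _ (2 * ((1 - a) / (1 - normc z) *
    (fine (mu I) + ccst s gam * C * (1 - a) `^ (s - gam - 1))))).
  by rewrite ler_wpM2l// ler_wpM2l// divr_ge0// ltW.
have -> : 2 * ((1 - a) / (1 - normc z) *
    (fine (mu I) + ccst s gam * C * (1 - a) `^ (s - gam - 1))) =
  2 / (1 - normc z) * (fine (mu I) * (1 - a) + ccst s gam * C *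
   ((1 - a) * (1 - a) `^ (s - gam - 1))) by ring.
rewrite e1 /A -[leRHS]mulrA ler_wpM2l ?divr_ge0 ?(ltW z0)// [leRHS]mulrDl lerD2r.
by rewrite ler_wpM2l// fine_ge0.
Qed.

(** If tails are not small, points [a n] tending to 1 keep a ratio above [eps]. The limit of a
    subsequence of images is zero by pointwise decay, so the images tend to zero in norm, against
    [Imu_bump_ge]. *)
Theorem small_tails_of_Imu_compact : small_tails mu s.
Proof.
have [C [C0 CP]] := carleson_ratio_bounded.
have tails : tail_le_from mu s 0 C.
  by move=> t t0 t1; apply: carleson_ratio_tail => //; exact: CP.
move=> eps eps0; apply: contrapT => nsmall.
have /choice[a aP] : forall n : nat, exists a, (0 <= a /\ a < 1) /\
    (1 - n.+1%:R^-1 <= a /\ eps < carleson_ratio a).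
  move=> n; apply: contrapT => na; apply: nsmall.
  have r0 : 0 <= 1 - n.+1%:R^-1 :> R by rewrite subr_ge0 invf_le1 ?ler1n.
  have r1 : 1 - n.+1%:R^-1 < 1 :> R by rewrite ltrBlDl ltrDr invr_gt0.
  exists (1 - n.+1%:R^-1); split=> //.
  move=> t rt t1; apply: carleson_ratio_tail => //.
  rewrite leNgt; apply/negP => h; apply: na; exists t; split; split => //.
  exact: le_trans rt.
have [phi [phi_k [g [[_ _] gP]]]] := bump_subsequence (fun n => (aP n).1).
have g0 z : inD z -> vw p z * normc (g z) <= 0.
  move=> zD; apply/ler_addgt0Pr => e e0; rewrite add0r.
  have e20 := divr_gt0 e0 (ltr0Sn R 1).
  have [N NP] := gP _ e20.
  have v0 := vw_gt0 p zD.
  have [r [r1 rP]] := Imu_bump_small C0 tails zD (divr_gt0 e20 v0).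
  pose k := maxn N (Num.bound (1 - r)^-1).
  have [[a0 a1] [ak _]] := aP (phi k).
  have ra : r < a (phi k).
    apply: lt_le_trans ak; rewrite ltrBrDl -ltrBrDr.
    rewrite invf_plt ?posrE ?subr_gt0//.
    apply: lt_le_trans (archi_boundP _) _; first by rewrite invr_ge0 subr_ge0 ltW.
    by rewrite ler_nat (leq_trans (leq_maxr N _))// leqW.
  have := rP _ a0 ra a1; have := NP k (leq_maxl _ _) z zD.
  move: (Imu mu _ _) => F h1 h2.
  rewrite [leRHS]splitr.
  apply: (@le_trans _ _ (vw p z * (normc (F - g z) + normc F))).
    rewrite ler_wpM2l ?(ltW v0)// addrC.
    by rewrite -{1}[g z](subKr F); exact: le_normcB.
  by rewrite mulrDr lerD// mulrC -ler_pdivlMr.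
(* The image is evaluated at the parameter of its own bump, where [Imu_bump_ge] forces more than
   [c0 * eps]. *)
have [N NP] := gP (c0 * eps / 2) (divr_gt0 (mulr_gt0 c0_gt0 eps0) (ltr0Sn R 1)).
have [[a0 a1] [_ aL]] := aP (phi N).
have aD := inD_real a0 a1.
have := NP N (leqnn _) _ aD.
have gz : g (a (phi N))%:C = 0.
  apply/eqP; rewrite -[_ == 0]negbK -normc_gt0 -leNgt.
  by have := g0 _ aD; rewrite pmulr_rle0 ?vw_gt0.
rewrite gz subr0 => h.
have := le_trans (Imu_bump_ge a0 a1 (bump_def a0 a1)) h.
rewrite -mulrA ler_pM2l// leNgt => /negP; apply; apply: le_lt_trans aL.
by rewrite ler_pdivrMr// ler_peMr ?ler1n// ltW.
Qed.

End Necessity.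

(** * Moments *)

Section Moments.
Variable R : realType.
Variable mu : {finite_measure set R -> \bar R}.
Variable s : R.

Local Notation I := (`[0, 1[%classic : set R).

Lemma vanishing_carlesonP : vanishing_carleson mu s <-> small_tails mu s.
Proof.
split=> [/cvgrPdist_le van e e0|small].
  have [d /= d0 dP] := van e e0.
  (* Halving [d] keeps [[r, 1)] strictly within distance [d] of 1. *)
  pose r := Num.max 0 (1 - d / 2).
  have r1 : r < 1 by rewrite gt_max ltr01 gtrBl divr_gt0.
  exists r; split => // [|t]; first by rewrite le_max lexx.
  rewrite ge_max => /andP[t0 td] t1; apply: carleson_ratio_tail => //.
  have := dP t _ t1; rewrite /= sub0r normrN => h.
  apply: le_trans (ler_norm _) (h _).
  rewrite ger0_norm ?subr_ge0 ?(ltW t1)//.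
  rewrite ltrBlDr -ltrBlDl; apply: lt_le_trans td.
  by rewrite ltrD2l ltrN2 ltr_pdivrMr// ltr_pMr// ltr1n.
apply/cvgrPdist_le => e /small[r [r0 r1 rP]]; near=> t.
have t1 : t < 1 by near: t; exact: nbhs_left_lt.
have rt : r <= t by near: t; exact: nbhs_left_ge.
rewrite sub0r normrN ger0_norm ?divr_ge0 ?fine_ge0 ?powR_ge0//.
rewrite ler_pdivrMr ?powR_gt0 ?subr_gt0// -lee_fin fineK ?fin_num_measure//.
exact: rP.
Unshelve. all: by end_near. Qed.

Lemma expr_integrable n : mu.-integrable I (EFin \o (fun t : R => t ^+ n)).
Proof.
have := finite_measure_integrable_cst mu (1 : R) (measurable_itv `[0, 1[).
apply: le_integrable => //.
  by apply/measurable_EFinP; exact: exprn_measurable.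
move=> t /itv01P[t0 t1] /=; rewrite lee_fin normr1 ger0_norm ?exprn_ge0//.
by rewrite exprn_ile1// ltW.
Qed.

Lemma moment_ge0 n : 0 <= moment mu n.
Proof. by apply: Rintegral_ge0 => t /itv01P[t0 _]; exact: exprn_ge0. Qed.

(** Raise [y / q <= exp(y / q)] to the power [q]. *)
Lemma powR_le_expR (q y : R) : 0 < q -> 0 <= y -> y `^ q <= q `^ q * expR y.
Proof.
move=> q0 y0; have yq : y = q * (y / q) by rewrite mulrC divfK// gt_eqF.
have e1 : expR y = expR (y / q) `^ q by rewrite -expRM divfK// gt_eqF.
rewrite [in leLHS]yq powRM ?divr_ge0 ?(ltW q0)// e1 ler_wpM2l ?powR_ge0//.
apply: ler_powR_ge0; rewrite ?divr_ge0 ?(ltW q0)//.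
by apply: le_trans (expR_ge1Dx _); rewrite lerDr.
Qed.

(** Since [t^n <= exp(-n(1 - t))], the exponential cancels the one from [powR_le_expR]. *)
Lemma expr_le_powR (q : R) (t : R) n : 0 < q -> 0 <= t -> t < 1 ->
  t ^+ n * (n%:R * (1 - t)) `^ q <= q `^ q.
Proof.
move=> q0 t0 t1; have u0 : 0 < 1 - t by rewrite subr_gt0.
have y0 : 0 <= n%:R * (1 - t) by rewrite mulr_ge0// ltW.
have te : t ^+ n <= expR (- (n%:R * (1 - t))).
  rewrite -mulrN mulrC expRM_natr lerXn2r ?nnegrE ?expR_ge0//.
  by apply: le_trans (expR_ge1Dx _); rewrite opprB addrC subrK.
apply: le_trans (ler_pM _ _ te (powR_le_expR q0 y0)) _.
- by rewrite exprn_ge0.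
- exact: powR_ge0.
by rewrite mulrCA -expRD addNr expR0 mulr1.
Qed.

Lemma bernoulli_le (u : R) n : 0 <= u -> u <= 1 -> 1 - n%:R * u <= (1 - u) ^+ n.
Proof.
move=> u0 u1; elim: n => [|n IH]; first by rewrite mul0r subr0 expr0.
rewrite exprS; apply: (@le_trans _ _ ((1 - u) * (1 - n%:R * u))).
  have := mulr_ge0 (ler0n R n) (mulr_ge0 u0 u0); rewrite -natr1; nra.
by rewrite ler_wpM2l// subr_ge0.
Qed.

(** By Bernoulli, [x^n >= t^n >= 1 - n(1 - t) >= 1/2] on [[t, 1)]. *)
Lemma tail_le_moment (t : R) n : 0 <= t -> t < 1 -> n%:R * (1 - t) <= 2^-1 ->
  fine (mu (`[t, 1[%classic : set R)) <= 2 * moment mu n.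
Proof.
move=> t0 t1 nt; have u0 : 0 < 1 - t by rewrite subr_gt0.
have tn x : (`[t, 1[%classic : set R) x -> 2^-1 <= x ^+ n.
  rewrite /= in_itv/= => /andP[tx x1]; apply: (@le_trans _ _ (t ^+ n)).
    have u1 : 1 - t <= 1 by rewrite gerBl.
    have := bernoulli_le n (ltW u0) u1; rewrite subKr; apply: le_trans.
    by rewrite lerBrDl -lerBrDr (le_trans nt)//; lra.
  by rewrite lerXn2r ?nnegrE// (le_trans t0).
rewrite mulrC -ler_pdivrMr// mulrC.
have subI : (`[t, 1[%classic : set R) `<=` I.
  by apply: subset_itvr; rewrite bnd_simp.
have ei := expr_integrable n.
rewrite -lee_fin EFinM fineK ?fin_num_measure//.
rewrite fineK; last by exact: integrable_fin_num ei.
rewrite -integral_cst//.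
apply: (@le_trans _ _ (\int[mu]_(x in `[t, 1%R[) (x ^+ n)%:E)%E).
  apply: ge0_le_integral => //.
    by move=> x _; rewrite lee_fin invr_ge0.
  by apply/measurable_EFinP; exact: exprn_measurable.
apply: ge0_subset_integral => //; first by case/integrableP: ei.
by move=> x /itv01P[x0 _]; rewrite lee_fin exprn_ge0.
Qed.

Hypothesis s0 : 0 < s.

Lemma small_tails_of_moments :
  (fun n : nat => n%:R `^ s * moment mu n) @ \oo --> 0 -> small_tails mu s.
Proof.
move=> /cvgrPdist_le mom e e0.
have c0 : 0 < 2 * (4 : R) `^ s by rewrite mulr_gt0// powR_gt0.
have [N _ NP] := mom _ (divr_gt0 e0 c0).
have N2 : 0 < 2 * N.+2%:R :> R by rewrite mulr_gt0.
pose r : R := 1 - (2 * N.+2%:R)^-1.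
have r1 : r < 1 by rewrite ltrBlDl ltrDr invr_gt0.
exists r; split => //.
  by rewrite subr_ge0 invf_le1// -natrM ler1n.
move=> t rt t1; apply: carleson_ratio_tail => //.
have u0 : 0 < 1 - t by rewrite subr_gt0.
have t0 : 0 <= t.
  by apply: le_trans rt; rewrite subr_ge0 invf_le1// -natrM ler1n.
(* The exponent [n] is the integer part of [y]: then [n(1 - t) <= 1/2], while [n >= y / 2] gives
   [4n(1 - t) >= 1]. The choice of [r] ensures [n >= N + 2], so [n] is also positive. *)
pose y := (2 * (1 - t))^-1.
have y0 : 0 < y by rewrite invr_gt0 mulr_gt0.
have yN : N.+2%:R <= y.
  rewrite -[leLHS]invrK lef_pV2 ?posrE ?invr_gt0 ?mulr_gt0//.
  rewrite -ler_pdivlMl// -invfM; rewrite /r lerBlDr -lerBlDl in rt.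
  by rewrite mulrC in rt *; exact: rt.
have /andP[ny yn] := truncn_itv (ltW y0).
set n := Num.trunc y in ny yn.
have Nn : (N.+2 <= n)%N.
  by rewrite -ltnS -(ltr_nat R); exact: le_lt_trans yN yn.
have n0 : 0 < n%:R :> R by rewrite ltr0n (leq_trans _ Nn).
have n2 : y / 2 <= n%:R.
  have : 1 <= n%:R :> R by rewrite ler1n (leq_trans _ Nn).
  move: yn; rewrite -natr1; lra.
have nt : n%:R * (1 - t) <= 2^-1.
  by rewrite -ler_pdivlMr// -invfM.
have h1 := tail_le_moment t0 t1 nt.
have := NP n; rewrite /= sub0r normrN ger0_norm ?mulr_ge0 ?powR_ge0 ?moment_ge0//.
move=> /(_ (leq_trans _ Nn)) h2.
have {}h2 : n%:R `^ s * moment mu n <= e / (2 * 4 `^ s) by apply: h2; rewrite leqW.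
rewrite /carleson_ratio ler_pdivrMr ?powR_gt0//.
apply: le_trans h1 _.
have n4 : 1 <= n%:R * (4 * (1 - t)).
  apply: (@le_trans _ _ (y / 2 * (4 * (1 - t)))).
    by rewrite /y le_eqVlt; apply/orP; left; apply/eqP; field; rewrite gt_eqF.
  by rewrite ler_wpM2r// mulr_ge0// ltW.
have n4s : 1 <= n%:R `^ s * (4 `^ s * (1 - t) `^ s).
  rewrite -powRM ?(ltW u0)// -powRM ?mulr_ge0 ?(ltW u0) ?(ltW n0)//.
  by rewrite -[leLHS](powR1E s) ler_powR_ge0// ltW.
apply: (@le_trans _ _ (2 * moment mu n * (n%:R `^ s * (4 `^ s * (1 - t) `^ s)))).
  by rewrite ler_peMr// mulr_ge0// moment_ge0.
rewrite ler_pdivlMr// in h2.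
apply: (@le_trans _ _ (n%:R `^ s * moment mu n * (2 * 4 `^ s) * (1 - t) `^ s)).
  by rewrite le_eqVlt; apply/orP; left; apply/eqP; ring.
by rewrite ler_wpM2r ?powR_ge0.
Qed.

Variable gam : R.
Hypotheses (gam0 : 0 < gam) (gams : gam < s) (sgam : s < gam + 1).

(** With [N = max(1 - t, 1/n)], the product [t^n (nN)^(gam + 1)] is bounded: by [t^n <= 1] if
    [N = 1/n], by [expr_le_powR] otherwise. Then [N^(-gam) <= (1 - t)^(-gam)]. *)
Lemma expr_le_ckern (t : R) n : (0 < n)%N -> I t ->
  t ^+ n <= (gam + 1) `^ (gam + 1) * n%:R `^ (- (gam + 1)) * ckern gam n%:R^-1 t.
Proof.
move=> n0 /itv01P[t0 t1]; have u0 : 0 < 1 - t by rewrite subr_gt0.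
have n0' : 0 < n%:R :> R by rewrite ltr0n.
pose N := Num.max (1 - t) n%:R^-1.
have N0 : 0 < N by rewrite lt_max u0.
have q0 : 0 < gam + 1 by rewrite addr_gt0.
have h : t ^+ n * (n%:R * N) `^ (gam + 1) <= (gam + 1) `^ (gam + 1).
  rewrite /N; case: (leP (1 - t) n%:R^-1) => _; last exact: expr_le_powR.
  rewrite mulfV ?gt_eqF// powR1 mulr1; apply: (@le_trans _ _ 1).
    by rewrite exprn_ile1// ltW.
  rewrite -[leLHS](powR1E (gam + 1)); apply: ler_powR_ge0; rewrite ?(ltW q0)//.
  by rewrite lerDr ltW.
rewrite powRM ?(ltW n0') ?(ltW N0)// in h.
apply: (@le_trans _ _ ((gam + 1) `^ (gam + 1) * n%:R `^ (- (gam + 1)) *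
    N `^ (- (gam + 1)))).
  by rewrite -mulrA !powRN -invfM ler_pdivlMr// mulr_gt0 ?powR_gt0.
rewrite ler_wpM2l ?mulr_ge0 ?powR_ge0// /ckern -/N opprD powRD_gt0//.
rewrite powR_inv1 ?(ltW N0)// ler_wpM2r ?invr_ge0 ?(ltW N0)//.
by rewrite ler_powRN ?(ltW gam0)// le_max lexx.
Qed.

(** Integrating [expr_le_ckern] at scale [1/n], the powers of [n] cancel in the tail term, which
    becomes [e / 2]; the mass term keeps a factor [n^(-(gam + 1 - s))] and vanishes. *)
Lemma moments_of_small_tails : small_tails mu s ->
  (fun n : nat => n%:R `^ s * moment mu n) @ \oo --> 0.
Proof.
move=> small; apply/cvgrPdist_le => e e0.
have cc := ccst_gt0 gams sgam.
pose Q : R := (gam + 1) `^ (gam + 1).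
have Q0 : 0 < Q by rewrite powR_gt0// addr_gt0.
have e2 : 0 < e / (2 * Q * ccst s gam) by rewrite divr_gt0 ?mulr_gt0.
have [r [r0 r1 rP]] := small _ e2.
pose A := (1 - r) `^ (- (gam + 1)) * fine (mu I).
have A0 : 0 <= A by rewrite mulr_ge0 ?powR_ge0// fine_ge0.
have A1 : 0 < A + 1 by rewrite ltr_wpDl.
have p0 : 0 < gam + 1 - s by rewrite subr_gt0.
have d0 : 0 < e / (2 * Q * (A + 1)) by rewrite divr_gt0 ?mulr_gt0.
have [r' [r'1 r'P]] := powR_small p0 d0.
exists (Num.bound (1 - r')^-1).+1 => // n /= nb.
have n0 : 0 < n%:R :> R by rewrite ltr0n (leq_trans _ nb).
have x0 : 0 < n%:R^-1 :> R by rewrite invr_gt0.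
rewrite sub0r normrN ger0_norm ?mulr_ge0 ?powR_ge0 ?moment_ge0//.
have xp : n%:R^-1 `^ (gam + 1 - s) <= e / (2 * Q * (A + 1)).
  rewrite -[n%:R^-1](subKr 1); apply: r'P; last by rewrite ltrBlDl ltrDr.
  rewrite ltrBrDl -ltrBrDr invf_plt ?posrE ?subr_gt0//.
  apply: lt_le_trans (archi_boundP _) _; first by rewrite invr_ge0 subr_ge0 ltW.
  by rewrite ler_nat ltnW.
have ki := ckern_integrable gam0 gams sgam r0 r1 (ltW e2) rP x0.
have kb := Rintegral_ckern_le gam0 gams sgam r0 r1 (ltW e2) rP x0.
rewrite -/A in kb.
pose c : R := Q * n%:R `^ (- (gam + 1)).
have c0 : 0 < c by rewrite mulr_gt0// powR_gt0.
have ci : mu.-integrable I (EFin \o (fun t => c * ckern gam n%:R^-1 t)).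
  by have := integrableZl (measurable_itv _) c ki; apply: eq_integrable.
have mb : moment mu n <= c * (A + ccst s gam * (e / (2 * Q * ccst s gam)) *
    n%:R^-1 `^ (s - gam - 1)).
  apply: (@le_trans _ _ (c * \int[mu]_(t in I) ckern gam n%:R^-1 t)).
    rewrite -RintegralZl//; apply: le_Rintegral => //.
      exact: expr_integrable.
    move=> t It; apply: expr_le_ckern => //.
    by rewrite -(ltr0n R).
  by rewrite ler_wpM2l ?(ltW c0).
apply: (@le_trans _ _ (n%:R `^ s * (c * (A + ccst s gam * (e / (2 * Q * ccst s gam)) *
    n%:R^-1 `^ (s - gam - 1))))); first by rewrite ler_wpM2l ?powR_ge0.
have eA : n%:R `^ s * n%:R `^ (- (gam + 1)) = n%:R^-1 `^ (gam + 1 - s).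
  rewrite powRV ?(ltW n0)// -powRN -powRD_gt0//; congr (_ `^ _); ring.
have eB : n%:R `^ s * n%:R `^ (- (gam + 1)) * n%:R^-1 `^ (s - gam - 1) = 1.
  rewrite powRV ?(ltW n0)// -powRN -!powRD_gt0//.
  by rewrite (_ : s - (gam + 1) - (s - gam - 1) = 0) ?powRr0//; ring.
have -> : n%:R `^ s * (c * (A + ccst s gam * (e / (2 * Q * ccst s gam)) *
    n%:R^-1 `^ (s - gam - 1))) =
  Q * A * (n%:R `^ s * n%:R `^ (- (gam + 1))) + e / 2 *
  (n%:R `^ s * n%:R `^ (- (gam + 1)) * n%:R^-1 `^ (s - gam - 1)).
  by rewrite /c; field; rewrite !gt_eqF.
rewrite eB eA mulr1 [leRHS]splitr lerD2r.
apply: (@le_trans _ _ (Q * (A + 1) * (e / (2 * Q * (A + 1))))).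
  by rewrite ler_pM ?powR_ge0 ?(mulr_ge0 (ltW Q0) A0)// ler_wpM2l ?(ltW Q0)// lerDl.
by rewrite le_eqVlt; apply/orP; left; apply/eqP; field; rewrite !gt_eqF.
Qed.

End Moments.

(** * The five equivalent conditions *)

Theorem theorem17 (R : realType) (mu : {finite_measure set R -> \bar R})
  (gam delta : R) :
  mu (~` `[0, 1[%classic) = 0%E ->
  0 < gam -> - gam < delta -> delta < 1 - gam ->
  [<->
    (* (i) *)
    Imu_compact mu (Hinf (vw gam)) (vw gam)
                   (Hinf (vw (gam + delta))) (vw (gam + delta));
    (* (ii) *)
    Imu_compact mu (Hinf (vw gam)) (vw gam)
                   (H0 (vw (gam + delta))) (vw (gam + delta));
    (* (iii) *)
    Imu_compact mu (H0 (vw gam)) (vw gam)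
                   (H0 (vw (gam + delta))) (vw (gam + delta)) /\
    mu.-integrable `[0, 1[%classic (fun t : R => ((vw gam t%:C)^-1)%:E);
    (* (iv) *)
    vanishing_carleson mu (1 - delta);
    (* (v) *)
    (fun n : nat => (n%:R `^ (1 - delta)) * moment mu n) @ \oo --> 0 ].
Proof.
move=> _ gam0 delta_gt delta_lt.
have gams : gam < 1 - delta by rewrite ltrBrDr -ltrBrDl.
have sgam : 1 - delta < gam + 1 by rewrite addrC ltrD2r ltrNl.
have s0 := lt_trans gam0 gams.
have pE : gam + delta = gam + 1 - (1 - delta) by ring.
have nec X Y : (forall f, H0 (vw gam) f -> X f) ->
    (forall f, Y f -> Hinf (vw (gam + delta)) f) ->
    Imu_compact mu X (vw gam) Y (vw (gam + delta)) -> small_tails mu (1 - delta).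
  by move=> HX YH; exact: small_tails_of_Imu_compact gam0 gams sgam pE _ _ HX YH.
have suf X Y : (forall f, X f -> Hinf (vw gam) f) ->
    (forall f, H0 (vw (gam + delta)) f -> Y f) -> small_tails mu (1 - delta) ->
    Imu_compact mu X (vw gam) Y (vw (gam + delta)).
  by move=> XH HY tails; exact: Imu_compact_of_small_tails gam0 gams sgam pE tails _ _ XH HY.
(* The implications are proved in a cycle. Each compactness condition is left through [nec] and
   reached through [suf], with [small_tails] in between. *)
tfae.
- by move=> /nec-/(_ (fun f h => h.1) (fun f h => h)); exact: suf.
- move=> /nec-/(_ (fun f h => h.1) (fun f h => h.1)) tails; split.
    by apply: suf => // f [].
  have [r [r0 r1 rP]] := tails 1 ltr01.
  have := weight_integrable gam0 gams sgam r0 r1 ler01 rP.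
  apply: eq_integrable => // t; rewrite inE => /itv01P[t0 t1].
  by rewrite /vw normc_real ger0_norm// powRN.
- by move=> [/nec-/(_ (fun f h => h) (fun f h => h.1)) tails _]; exact/vanishing_carlesonP.
- by move/vanishing_carlesonP => tails; exact: moments_of_small_tails gams sgam tails.
- by move/small_tails_of_moments => /(_ s0); apply: suf => // f [].
Qed.
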